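(* Let $f\in\dot V_p^k$ and suppose that the smoothness $s:=d/p$ of $\dot V_p^k$ satisfies $k>s$. Then $f\in\dot{\mathrm v}_p^k$ if and only if $$\lim_{\varepsilon\to0}\ \sup_{d(\pi)\le\varepsilon}\Big(\sum_{Q\in\pi}E_k(f;Q)^p\Big)^{1/p}=0,$$ where the supremum is over $\pi\in\Pi$ with $d(\pi):=\sup_{Q\in\pi}|Q|\le\varepsilon$.
   Context: Fix $d,k\in\mathbb N$, $1\le p<\infty$, and let $Q^d:=[0,1]^d$. A cube is a closed cube in $\mathbb R^d$ homothetic to $Q^d$; $|Q|$ is its $d$-dimensional Lebesgue measure. A packing is a family of cubes with pairwise disjoint interiors; $\Pi$ is the set of finite packings consisting of cubes contained in $Q^d$. $\mathcal P_{k-1}^d$ is the space of real polynomials on $\mathbb R^d$ of degree at most $k-1$. $\ell_\infty(Q^d)$ is the space of all bounded functions $f:Q^d\to\mathbb R$. For a cube $Q\subset Q^d$, $E_k(f;Q):=\inf_{m\in\mathcal P_{k-1}^d}\sup_Q|f-m|$. The space $\dot V_p^k$ consists of all $f\in\ell_\infty(Q^d)$ such that $$|f|_{V_p^k}:=\sup_{\pi\in\Pi}\Big(\sum_{Q\in\pi}E_k(f;Q)^p\Big)^{1/p}<\infty,$$ with seminorm $|\cdot|_{V_p^k}$. Let $C^\infty$ be the set of restrictions to $Q^d$ of functions in $C^\infty(\mathbb R^d)$. The subspace $\dot{\mathrm v}_p^k$ is the closure of $C^\infty\cap\dot V_p^k$ in $\dot V_p^k$ with respect to $|\cdot|_{V_p^k}$.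 *)

(* Defs.v *)
From HB Require Import structures.
From mathcomp Require Import all_boot all_order all_algebra.
From mathcomp Require Import all_classical all_reals all_analysis.
(* The notations of mpoly clash with those of the analysis library. *)
From mathcomp.multinomials Require Import -(notations) mpoly.

Set Implicit Arguments.
Unset Strict Implicit.
Unset Printing Implicit Defensive.

Import Order.TTheory GRing.Theory Num.Theory.
Import numFieldNormedType.Exports.

Local Open Scope classical_set_scope.
Local Open Scope ring_scope.

(* A function on the unit cube is represented by a total function on R^d; every
   notion below depends only on its values on the unit cube, except [smooth],
   which concerns functions on the whole of R^d. *)

Definition unit_cube (R : realType) (d : nat) : set 'rV[R]_d :=
  [set x | forall i, 0 <= x ord0 i <= 1].
Arguments unit_cube : clear implicits.

(* A pair Q = (a, r) with r > 0 stands for the cube a + r [0,1]^d; for d > 0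
   distinct pairs give distinct cubes. *)
Definition cube_set (R : realType) (d : nat) (Q : 'rV[R]_d * R) :
    set 'rV[R]_d :=
  [set Q.1 + Q.2 *: x | x in unit_cube R d].

(* The Lebesgue measure of the cube; the library provides Lebesgue measure on
   the real line only. *)
Definition cube_vol (R : realType) (d : nat) (Q : 'rV[R]_d * R) : R :=
  Q.2 ^+ d.

(* Cubes of a packing are nondegenerate, so disjointness of the interiors of
   distinct members is what [trivIset] expresses. *)
Definition packing (R : realType) (d : nat) (pi : set ('rV[R]_d * R)) : Prop :=
  [/\ finite_set pi,
      forall Q, pi Q -> 0 < Q.2 /\ cube_set Q `<=` unit_cube R d &
      trivIset pi (fun Q => interior (cube_set Q))].

(* The supremum of the empty family is -oo, so the empty packing has mesh at
   most eps for every eps. *)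
Definition mesh (R : realType) (d : nat) (pi : set ('rV[R]_d * R)) : \bar R :=
  ereal_sup [set (cube_vol Q)%:E | Q in pi].

(* [mpoly.msize m] is the total degree plus one (and 0 for m = 0), so the
   condition below means: degree at most k - 1. *)
Definition poly_lt (R : realType) (d k : nat) : set (mpoly.mpoly d R) :=
  [set m : mpoly.mpoly d R | (mpoly.msize m <= k)%N].

Definition poly_fun (R : realType) (d : nat) (m : mpoly.mpoly d R)
    (x : 'rV[R]_d) : R :=
  mpoly.meval (fun i => x ord0 i) m.

(* E_k(f; A). *)
Definition best_approx (R : realType) (d k : nat) (f : 'rV[R]_d -> R)
    (A : set 'rV[R]_d) : \bar R :=
  ereal_inf [set ereal_sup [set `|f x - poly_fun m x|%:E | x in A]
            | m in @poly_lt R d k].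

Definition packing_var (R : realType) (d k : nat) (p : R)
    (f : 'rV[R]_d -> R) (pi : set ('rV[R]_d * R)) : \bar R :=
  ((\sum_(Q \in pi) (best_approx k f (cube_set Q) `^ p)) `^ p^-1)%E.

Definition V_seminorm (R : realType) (d k : nat) (p : R)
    (f : 'rV[R]_d -> R) : \bar R :=
  ereal_sup [set packing_var k p f pi | pi in @packing R d].

Definition V_space (R : realType) (d k : nat) (p : R) :
    set ('rV[R]_d -> R) :=
  [set f | [bounded f x | x in unit_cube R d] /\
           (V_seminorm k p f < +oo)%E].

Fixpoint Cn (R : realType) (d n : nat) (g : 'rV[R]_d -> R) : Prop :=
  match n with
  | 0%N => continuous g
  | n'.+1 => continuous g /\ forall i : 'I_d,
      (forall x, derivable g x (delta_mx ord0 i)) /\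
      Cn n' (fun x => derive g x (delta_mx ord0 i))
  end.

Definition smooth (R : realType) (d : nat) (g : 'rV[R]_d -> R) : Prop :=
  forall n, Cn n g.

Definition C_infty (R : realType) (d : nat) : set ('rV[R]_d -> R) :=
  [set f | exists2 g : 'rV[R]_d -> R, smooth g &
           forall x, unit_cube R d x -> f x = g x].

(* Closure of C_infty `&` V_space in V_space, for the seminorm. *)
Definition v_space (R : realType) (d k : nat) (p : R) :
    set ('rV[R]_d -> R) :=
  [set f | V_space k p f /\
     forall e : R, 0 < e -> exists2 g : 'rV[R]_d -> R,
       (@C_infty R d `&` V_space k p) g &
       (V_seminorm k p (fun x => (f x - g x)%R) < e%:E)%E].

Definition small_var (R : realType) (d k : nat) (p : R)
    (f : 'rV[R]_d -> R) (eps : R) : \bar R :=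
  ereal_sup [set packing_var k p f pi
            | pi in [set pi | packing pi /\ (mesh pi <= eps%:E)%E]].

(* Main.v *)
Require Import Defs.
From mathcomp Require Import all_boot all_order all_algebra qpoly.
From mathcomp Require Import all_classical all_reals all_analysis.
From mathcomp.multinomials Require Import -(notations) mpoly.
From mathcomp Require Import zify ring lra.

Set Implicit Arguments.
Unset Strict Implicit.
Unset Printing Implicit Defensive.

Import Order.TTheory GRing.Theory Num.Theory.
Import numFieldNormedType.Exports.

Local Open Scope classical_set_scope.
Local Open Scope ring_scope.

(** Why the theorem holds. Write E(f; Q) for the distance of f to the polynomials of
    degree less than k on the cube Q.

    If g is smooth, then E(g; Q) is at most C r^k on cubes of side r, by Taylor's
    formula ([smooth_poly_approx]). The sum of E(g; Q)^p over a packing is then at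
    most C^p times the sum of r^(kp) = r^d r^(kp - d), and the r^d sum up to a bounded
    quantity since the cubes do not overlap ([volume_le]). As kp > d, smooth functions
    have finite variation, and vanishing variation over small cubes
    ([smooth_var_sum]). The second property passes to limits in the seminorm
    ([v_space_small_var]).

    Conversely, suppose that the variation of f over small cubes vanishes. Divide
    the unit cube into N^d cells, and blend Lagrange interpolants of f with nodes
    near each grid point by means of a smooth partition of unity. The result is a
    smooth function G = [quasi_interp] depending linearly on finitely many values of
    f, locally (the value at x involves only nodes at distance at most 2/N in each
    coordinate) and reproducing the polynomials q of degree less than k
    ([quasi_interp_poly]). Therefore G = q + (sum of the kernels weighted by the
    values of f - q at nearby nodes). With q a nearly best approximant of f on a cube
    of side 6/N around a cell z, the star of z, and e(z) the distance of f to the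
    polynomials on the star, this identity gives at once |f - G| <= L e(z) on the cell
    and E(G; Q) <= L e(z) (N r)^k for cubes Q of side r <= 1/N attached to the cell
    ([quasi_interp_near], [quasi_interp_approx]).

    Let now Q run through a packing. If Q is small, E(f - G; Q) is at most E(f; Q) +
    E(G; Q); if Q is large, it is at most the maximum of |f - G| over Q, hence at most
    L e(z) for some cell z that meets Q ([err_quasi_interp]). In the sum of the p-th
    powers the terms E(f; Q)^p are controlled by hypothesis. The others are grouped by
    cells: the cubes attached to one cell, shrunk to side at most 1/N, do not overlap
    and lie in a common box of side 3/N, so each cell contributes a bounded multiple
    of e(z)^p ([sum_capped_le]). Finally the stars form boundedly many packings by
    cubes of side 6/N, so the sum of the e(z)^p is controlled by hypothesis too
    ([sum_star_err_le]). Hence f - G has small variation when N is large. *)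

(** * Polynomial functions *)

(** Polynomials enter the proof only through the functions they define. *)
Definition is_poly (R : realType) (d n : nat) (q : 'rV[R]_d -> R) : Prop :=
  exists2 m : mpoly.mpoly d R, poly_lt n m & forall x, q x = poly_fun m x.

Section PolynomialFunctions.
Variables (R : realType) (d : nat).
Implicit Types (q : 'rV[R]_d -> R) (x : 'rV[R]_d).

Lemma is_poly_ext n q q' : q =1 q' -> is_poly n q -> is_poly n q'.
Proof. by move=> e [m mn mq]; exists m => // x; rewrite -e. Qed.

Lemma is_poly_leq n n' q : (n <= n')%N -> is_poly n q -> is_poly n' q.
Proof. by move=> nn' [m mn mq]; exists m => //; exact: leq_trans nn'. Qed.

Lemma is_poly_cst n (c : R) : is_poly n.+1 (fun _ : 'rV[R]_d => c).
Proof.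
exists (mpolyC d c); last by move=> x; rewrite /poly_fun mevalC.
by rewrite /poly_lt /= msizeC; case: (_ == _).
Qed.

Lemma is_poly0 n : is_poly n (fun _ : 'rV[R]_d => 0).
Proof.
exists 0; last by move=> x; rewrite /poly_fun meval0.
by rewrite /poly_lt /= msize0.
Qed.

Lemma is_polyD n q q' :
  is_poly n q -> is_poly n q' -> is_poly n (fun x => q x + q' x).
Proof.
move=> [m mn mq] [m' mn' mq']; exists (m + m').
  by rewrite /poly_lt/= (leq_trans (msizeD_le _ _))// geq_max mn mn'.
by move=> x; rewrite /poly_fun mevalD mq mq'.
Qed.

Lemma is_polyZ n (c : R) q : is_poly n q -> is_poly n (fun x => c * q x).
Proof.
move=> [m mn mq]; exists (c *: m).
  exact: leq_trans (msizeZ_le _ _) mn.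
by move=> x; rewrite /poly_fun mevalZ mq.
Qed.

Lemma is_polyB n q q' :
  is_poly n q -> is_poly n q' -> is_poly n (fun x => q x - q' x).
Proof.
move=> hq hq'; have := is_polyD hq (is_polyZ (-1) hq').
by apply: is_poly_ext => x; rewrite mulN1r.
Qed.

Lemma is_poly_sum (I : Type) (s : seq I) (P : pred I) n
    (q : I -> 'rV[R]_d -> R) :
  (forall i, is_poly n (q i)) -> is_poly n (fun x => \sum_(i <- s | P i) q i x).
Proof.
move=> qn; elim: s => [|i s IH].
  by apply: (is_poly_ext _ (is_poly0 n)) => x; rewrite big_nil.
case: (boolP (P i)) => Pi; last first.
  by apply: (is_poly_ext _ IH) => x; rewrite big_cons (negbTE Pi).
by apply: (is_poly_ext _ (is_polyD (qn i) IH)) => x; rewrite big_cons Pi.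
Qed.

Lemma is_polyM n n' q q' :
  is_poly n.+1 q -> is_poly n'.+1 q' -> is_poly (n + n').+1 (fun x => q x * q' x).
Proof.
move=> [m mn mq] [m' mn' mq']; exists (m * m'); last first.
  by move=> x; rewrite /poly_fun mevalM mq mq'.
rewrite /poly_lt /=; have [->|m0] := eqVneq m 0; first by rewrite mul0r msize0.
have [->|m'0] := eqVneq m' 0; first by rewrite mulr0 msize0.
rewrite msizeM// -subn1 leq_subLR.
by apply: leq_trans (leq_add mn mn') _; rewrite addSn addnS.
Qed.

Lemma is_polyX n e q :
  is_poly n.+1 q -> is_poly (n * e).+1 (fun x => q x ^+ e).
Proof.
move=> hq; elim: e => [|e IH].
  by apply: is_poly_ext (is_poly_cst _ 1) => x; rewrite expr0.
rewrite mulnS; apply: is_poly_ext (is_polyM hq IH) => x.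
by rewrite exprS.
Qed.

Lemma is_poly_prod (I : Type) (s : seq I) (e : I -> nat)
    (q : I -> 'rV[R]_d -> R) :
  (forall i, is_poly (e i).+1 (q i)) ->
  is_poly (\sum_(i <- s) e i).+1 (fun x => \prod_(i <- s) q i x).
Proof.
move=> qn; elim: s => [|i s IH].
  rewrite big_nil; apply: is_poly_ext (is_poly_cst _ 1) => x.
  by rewrite big_nil.
rewrite big_cons; apply: is_poly_ext (is_polyM (qn i) IH) => x.
by rewrite big_cons.
Qed.

Lemma is_poly_coord (i : 'I_d) : is_poly 2 (fun x => x ord0 i).
Proof.
exists (mpolyX R (mnm1 i)); last by move=> x; rewrite /poly_fun mevalXU.
by rewrite /poly_lt/= msizeX mdeg1.
Qed.

Lemma is_poly_monomials n q : is_poly n q ->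
  exists (s : seq (multinom d)) (c : multinom d -> R),
    (forall m, m \in s -> (\sum_(i < d) m i < n)%N) /\
    (forall x, q x = \sum_(m <- s) c m * \prod_(i < d) x ord0 i ^+ m i).
Proof.
move=> [m mn mq]; exists (msupp m), (fun a => mcoeff a m); split.
  by move=> a /msize_mdeg_lt; rewrite mdegE => /leq_trans; apply.
by move=> x; rewrite mq /poly_fun mevalE.
Qed.

(** Affine changes of variables preserve the degree; this transports local
   estimates from the unit scale to the scale of a grid. *)
Lemma is_poly_affine n q (c : R) (b : 'rV[R]_d) :
  is_poly n q -> is_poly n (fun x => q (c *: x - b)).
Proof.
move=> /is_poly_monomials[s [a [sn qE]]].
have -> : (fun x => q (c *: x - b)) = fun x => \sum_(m <- s | m \in s)
     a m * \prod_(i < d) (c * x ord0 i - b ord0 i) ^+ m i.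
  apply/funext => x; rewrite qE -big_seq; apply: eq_bigr => m _.
  by congr (_ * _); apply: eq_bigr => i _; rewrite !mxE.
pose t m : 'rV[R]_d -> R := if m \in s then fun x =>
  a m * \prod_(i < d) (c * x ord0 i - b ord0 i) ^+ m i else fun=> 0.
apply: (@is_poly_ext _ (fun x => \sum_(m <- s | m \in s) t m x)).
  by move=> x; apply: eq_bigr => m ms; rewrite /t ms.
apply: is_poly_sum => m; rewrite /t; case: ifPn => ms; last exact: is_poly0.
apply: is_polyZ; apply: is_poly_leq (sn _ ms) _.
apply: is_poly_prod => i; apply: (@is_poly_leq (1 * m i).+1); first by rewrite mul1n.
apply: is_polyX; apply: is_polyB; last exact: is_poly_cst.
exact/is_polyZ/is_poly_coord.
Qed.

End PolynomialFunctions.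

(** * A smooth partition of unity on the line *)

Fixpoint derivable_n (R : realType) (n : nat) (u : R -> R) : Prop :=
  if n is n'.+1 then (forall x, derivable u x 1) /\ derivable_n n' u^`()%classic
  else True.

Definition smooth1 (R : realType) (u : R -> R) := forall n, derivable_n n u.

Section SmoothFunctionsOfOneVariable.
Variable R : realType.
Implicit Types (u v : R -> R) (x : R).

Lemma scaleRE (a b : R) : a *: b = a * b.
Proof. by []. Qed.

Lemma is_derive_derive1 u u' : (forall x, is_derive x 1 u (u' x)) -> u^`()%classic = u'.
Proof.
by move=> du; apply/funext => x; rewrite derive1E; apply: (@derive_val _ _ _ _ _ _ _ (du x)).
Qed.

Lemma derivable_nS n u u' : (forall x, is_derive x 1 u (u' x)) ->
  derivable_n n u' -> derivable_n n.+1 u.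
Proof.
move=> du nu'; split; last by rewrite (is_derive_derive1 du).
by move=> x; have [] := du x.
Qed.

Lemma derivable_n_is_derive n u : derivable_n n.+1 u ->
  forall x, is_derive x 1 u (u^`()%classic x).
Proof. by move=> [du _] x; rewrite derive1E; apply: derivableP. Qed.

Lemma derivable_nW n u : derivable_n n.+1 u -> derivable_n n u.
Proof.
elim: n u => [//|n IH] u [du nu]; split => //.
exact: IH.
Qed.

(** Coinduction: a class of functions closed under derivation consists of
    smooth functions. *)
Lemma smooth1_coind (S : set (R -> R)) :
  (forall u, S u -> exists2 u', S u' & forall x, is_derive x 1 u (u' x)) ->
  forall u, S u -> smooth1 u.
Proof.
move=> HS u Su n; elim: n u Su => [//|n IH] u /HS[u' Su' du].
by apply: (derivable_nS du); exact: IH.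
Qed.

Lemma smooth1_cst (c : R) : smooth1 (fun=> c).
Proof.
apply: (@smooth1_coind [set u | exists c, u = fun=> c]); last by exists c.
move=> _ [{}c ->]; exists (fun=> 0); first by exists 0.
by move=> x; apply: is_derive_cst.
Qed.

Lemma derivable_nD n u v : derivable_n n u -> derivable_n n v ->
  derivable_n n (fun x => u x + v x).
Proof.
elim: n u v => [//|n IH] u v nu nv.
apply: (@derivable_nS _ _ (fun x => u^`()%classic x + v^`()%classic x)).
  move=> x; apply: is_deriveD.
    exact: (derivable_n_is_derive nu).
  exact: (derivable_n_is_derive nv).
by have [[_ nu'] [_ nv']] := (nu, nv); exact: IH.
Qed.

Lemma derivable_nM n u v : derivable_n n u -> derivable_n n v ->
  derivable_n n (fun x => u x * v x).
Proof.
elim: n u v => [//|n IH] u v nu nv.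
apply: (@derivable_nS _ _ (fun x => u x * v^`()%classic x + v x * u^`()%classic x)).
  move=> x; apply: is_deriveM.
    exact: (derivable_n_is_derive nu).
  exact: (derivable_n_is_derive nv).
have [[_ nu'] [_ nv']] := (nu, nv).
by apply: derivable_nD; apply: IH => //; exact: derivable_nW.
Qed.

Lemma smooth1D u v : smooth1 u -> smooth1 v -> smooth1 (fun x => u x + v x).
Proof. by move=> su sv n; apply: derivable_nD. Qed.

Lemma smooth1M u v : smooth1 u -> smooth1 v -> smooth1 (fun x => u x * v x).
Proof. by move=> su sv n; apply: derivable_nM. Qed.

Lemma smooth1B u v : smooth1 u -> smooth1 v -> smooth1 (fun x => u x - v x).
Proof.
move=> su sv; rewrite (_ : (fun x => _) = fun x => u x + (-1) * v x).
  by apply: smooth1D => //; apply: smooth1M => //; exact: smooth1_cst.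
by apply/funext => x; rewrite mulN1r.
Qed.

Lemma smooth1V u : (forall x, u x != 0) -> smooth1 u ->
  smooth1 (fun x => (u x)^-1).
Proof.
move=> u0 su; elim=> [//|n IH].
apply: (@derivable_nS n (fun x => (u x)^-1) (fun x => (- u^`()%classic x) * ((u x)^-1 * (u x)^-1))).
  move=> x; have du := derivable_n_is_derive (su 1%N) x.
  have [dux _] := du.
  apply: DeriveDef; first exact: derivableV.
  rewrite deriveV// (@derive_val _ _ _ _ _ _ _ du).
  by rewrite scaleRE expr2 invfM !mulNr mulrC.
apply: (@derivable_nM _ (fun x => - u^`()%classic x)); last by apply: derivable_nM.
rewrite (_ : (fun x => - _) = fun x => (-1) * u^`()%classic x); last first.
  by apply/funext => x; rewrite mulN1r.
apply: derivable_nM; first exact: smooth1_cst.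
by have [] := su n.+1.
Qed.

Lemma smooth1_affine (c b : R) u : smooth1 u -> smooth1 (fun x => u (c * x + b)).
Proof.
move=> su n; elim: n u su => [//|n IH] u su.
apply: (@derivable_nS n (fun x => u (c * x + b))
  (fun x => u^`()%classic (c * x + b) * c)).
  move=> x.
  apply: (@is_derive1_comp _ u (fun x => c * x + b)).
    exact: derivable_n_is_derive (su 1%N) _.
  have := is_deriveD (is_deriveZ c (is_derive_id x (1 : R))) (is_derive_cst b x 1).
  by rewrite addr0 scaleRE mulr1.
apply: derivable_nM; last exact: smooth1_cst.
by apply: IH => m; have [] := su m.+1.
Qed.

Lemma smooth1_horner (p : {poly R}) : smooth1 (horner p).
Proof.
apply: (@smooth1_coind [set u | exists p : {poly R}, u = horner p]); last by exists p.
move=> _ [{}p ->]; exists (horner p^`()%R); first by exists p^`()%R.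
exact: is_derive_poly.
Qed.

(** The functions P(1/x) exp(-1/x) extended by 0 to x <= 0: with all polynomials
    P allowed, the class is closed under derivation. *)
Definition flat (P : {poly R}) (x : R) : R :=
  if 0 < x then P.[x^-1] * expR (- x^-1) else 0.

Lemma horner_le_expR (P : {poly R}) :
  exists2 C, 0 <= C & forall y, 0 <= y -> `|P.[y]| <= C * expR y.
Proof.
exists (\sum_(i < size P) `|P`_i| * i`!%:R).
  by apply: sumr_ge0 => i _; rewrite mulr_ge0.
move=> y y0; rewrite horner_coef mulr_suml (le_trans (ler_norm_sum _ _ _))//.
apply: ler_sum => i _; rewrite normrM -mulrA ler_wpM2l// ger0_norm ?exprn_ge0//.
case: (nat_of_ord i) => [|j].
  by rewrite expr0 fact0 mul1r (le_trans _ (expR_ge1Dx _))// lerDl.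
have h := expR_ge1Dxn j y0.
rewrite mulrC -ler_pdivrMr ?ltr0n ?fact_gt0//.
by apply: le_trans h; rewrite lerDr.
Qed.

(** The quadratic bound makes the derivative at 0 vanish. *)
Lemma flat_le_sqr (P : {poly R}) :
  exists2 C, 0 <= C & forall x, `|flat P x| <= C * x ^+ 2.
Proof.
have [C C0 HC] := horner_le_expR (P * 'X^2).
exists C => // x; rewrite /flat; case: ifPn => x0; last first.
  by rewrite normr0 mulr_ge0// sqr_ge0.
have y0 : 0 <= x^-1 by rewrite invr_ge0 ltW.
have := HC _ y0; rewrite hornerM hornerXn normrM (ger0_norm (exprn_ge0 2 y0)).
rewrite -ler_pdivlMr ?exprn_gt0 ?invr_gt0// => h.
rewrite normrM (ger0_norm (expR_ge0 _)) expRN ler_pdivrMr ?expR_gt0//; apply: le_trans h _.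
by rewrite exprVn invrK mulrAC.
Qed.

Lemma is_derive_flat (P : {poly R}) (x : R) :
  is_derive x 1 (flat P) (flat ((P - P^`()%R) * 'X^2) x).
Proof.
have [x0|x0|x0] := ltgtP x 0.
- rewrite /flat ltNge (ltW x0)/=; apply: near_eq_is_derive (is_derive_cst 0 x 1).
  near=> y; rewrite ifF//; apply/negbTE; rewrite -leNgt ltW//.
  by near: y; exact: lt_nbhsl.
- have -> : flat ((P - P^`()%R) * 'X^2) x =
     P.[x^-1] * (expR (- x^-1) * x ^- 2)
     + expR (- x^-1) * (P^`()%R.[x^-1] * - x ^- 2).
    rewrite /flat x0 hornerM hornerD hornerN hornerXn exprVn; ring.
  apply: (@near_eq_is_derive _ _ _
      (fun y : R => (P.[y^-1] * expR (- y^-1)))).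
    near=> y; rewrite /flat ifT//; near: y; exact: lt_nbhsr.
  have dV : is_derive x 1 (fun y : R => y^-1) (- x ^- 2).
    apply: DeriveDef; first by apply: derivableV; rewrite ?gt_eqF.
    by rewrite deriveV ?gt_eqF// derive_id scaleRE mulr1.
  have d1 := @is_derive1_comp _ (horner P) _ _ _ _ (is_derive_poly P x^-1) dV.
  have d2 := @is_derive1_comp _ expR (- (fun y : R => y^-1)) _ _ _ (is_derive_expR (- x^-1))
    (is_deriveN dV).
  by have := is_deriveM d1 d2; rewrite opprK.
- have e0 Q : flat Q 0 = 0 by rewrite /flat ltxx.
  rewrite x0 e0.
  suff H : (fun h => h^-1 *: ((flat P \o shift 0) (h *: (1:R)) - flat P 0))
      @ 0^' --> (0 : R).
    apply: DeriveDef; last exact: cvg_lim H.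
    by apply/cvg_ex; exists 0.
  have [C C0 HC] := flat_le_sqr P.
  apply/cvgr0Pnorm_le => e e0'; near=> h => /=.
  rewrite e0 subr0 addr0 !scaleRE mulr1 normrM.
  have hn0 : h != 0 by near: h; exact: nbhs_dnbhs_neq.
  rewrite normfV mulrC ler_pdivrMr ?normr_gt0//.
  apply: (le_trans (HC h)); rewrite -(real_normK (num_real h)) expr2 mulrA ler_wpM2r//.
  have : `|h| <= e / (C + 1).
    near: h; apply: dnbhs0_le; by rewrite divr_gt0// ltr_wpDl.
  rewrite ler_pdivlMr ?ltr_wpDl// => /(le_trans _); apply.
  by rewrite mulrC ler_wpM2l// lerDl.
Unshelve. all: by end_near. Qed.

Lemma smooth1_flat P : smooth1 (flat P).
Proof.
apply: (@smooth1_coind [set u | exists P, u = flat P]); last by exists P.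
move=> _ [{}P ->]; exists (flat ((P - P^`()%R) * 'X^2)); first by exists ((P - P^`()%R) * 'X^2).
exact: is_derive_flat.
Qed.

Lemma flat1_ge0 x : 0 <= flat 1 x.
Proof. by rewrite /flat; case: ifP => // _; rewrite hornerC mul1r expR_ge0. Qed.

Lemma flat1_gt0 x : 0 < x -> 0 < flat 1 x.
Proof. by rewrite /flat => ->; rewrite hornerC mul1r expR_gt0. Qed.

Lemma flat1_eq0 x : x <= 0 -> flat 1 x = 0.
Proof. by move=> x0; rewrite /flat ltNge x0. Qed.

Definition smooth_step x := flat 1 x / (flat 1 x + flat 1 (1 - x)).

Lemma smooth_step0 x : x <= 0 -> smooth_step x = 0.
Proof. by move=> x0; rewrite /smooth_step flat1_eq0 ?mul0r. Qed.

Lemma smooth_step_den_gt0 x : 0 < flat 1 x + flat 1 (1 - x).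
Proof.
have [x0|x0] := ltP 0 x; first by rewrite ltr_pwDl ?flat1_gt0 ?flat1_ge0.
by rewrite ltr_wpDl ?flat1_ge0// flat1_gt0//; lra.
Qed.

Lemma smooth_step1 x : 1 <= x -> smooth_step x = 1.
Proof.
move=> x1; have := smooth_step_den_gt0 x.
by rewrite /smooth_step [flat 1 (1 - x)]flat1_eq0 ?addr0 ?subr_le0// => /gt_eqF/negbT/divff.
Qed.

Lemma smooth1_step : smooth1 smooth_step.
Proof.
apply: smooth1M; first exact: smooth1_flat.
apply: smooth1V => [x|]; first by rewrite gt_eqF// smooth_step_den_gt0.
apply: smooth1D; first exact: smooth1_flat.
rewrite (_ : (fun x => _) = fun x => flat 1 (-1 * x + 1)).
  exact/smooth1_affine/smooth1_flat.
by apply/funext => x; rewrite mulN1r addrC.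
Qed.

Definition bump x := smooth_step (x + 1) - smooth_step x.

Lemma smooth1_bump : smooth1 bump.
Proof.
apply: smooth1B; last exact: smooth1_step.
rewrite (_ : (fun x => _) = fun x => smooth_step (1 * x + 1)).
  exact/smooth1_affine/smooth1_step.
by apply/funext => x; rewrite mul1r.
Qed.

Lemma bump_eq0 x : 1 < `|x| -> bump x = 0.
Proof.
rewrite lter_normr /bump => /orP[x1|x1].
  by rewrite !smooth_step1 ?subrr//; lra.
by rewrite !smooth_step0 ?subrr//; lra.
Qed.

(** The integer translates of the bump telescope. *)
Lemma sum_bump (N : nat) x : 0 <= x <= N%:R ->
  \sum_(j < N.+1) bump (x - j%:R) = 1.
Proof.
move=> /andP[x0 xN].
pose F (j : nat) := - smooth_step (x + 1 - j%:R).
rewrite (eq_bigr (fun j : 'I_N.+1 => F j.+1 - F j)); last first.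
  move=> j _; rewrite /bump /F opprK addrC -natr1.
  by congr (- smooth_step _ + smooth_step _); ring.
rewrite -(big_mkord xpredT (fun j => F j.+1 - F j)) telescope_sumr// /F.
rewrite (@smooth_step1 (x + 1 - 0%:R)) ?(@smooth_step0 (x + 1 - N.+1%:R)).
- by rewrite oppr0 sub0r opprK.
- by rewrite -natr1; lra.
- by rewrite subr0 lerDr.
Qed.

End SmoothFunctionsOfOneVariable.

(** * Smooth functions of several variables *)

Section SmoothFunctionsOfSeveralVariables.
Variables (R : realType) (d : nat).
Implicit Types (g : 'rV[R]_d -> R) (x : 'rV[R]_d) (u : 'I_d -> R -> R).

Let e (i : 'I_d) : 'rV[R]_d := delta_mx ord0 i.

Lemma is_derive_line (V : normedModType R) (g : V -> R) (x v : V) (t l : R) :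
  is_derive (t *: v + x) v g l <-> is_derive t 1 (fun t => g (t *: v + x)) l.
Proof.
have E : (fun h : R => h^-1 *: ((g \o shift (t *: v + x)) (h *: v) - g (t *: v + x)))
  = (fun h : R => h^-1 *: (((fun t => g (t *: v + x)) \o shift t) (h *: (1 : R))
      - g (t *: v + x))).
  apply/funext => h /=; rewrite scaleRE mulr1.
  by rewrite scalerDl addrA.
by split=> -[H1 H2]; apply: DeriveDef; move: H1 H2; rewrite /derivable /derive E.
Qed.

Definition tensor u x := \prod_(i < d) u i (x ord0 i).

Definition tensor_diff u (i : 'I_d) : 'I_d -> R -> R :=
  fun j => if j == i then (u i)^`()%classic else u j.

(** Along the i-th axis only the i-th factor varies. *)
Lemma is_derive_tensor u i x : (forall y, derivable (u i) y 1) ->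
  is_derive x (e i) (tensor u) (tensor (tensor_diff u i) x).
Proof.
move=> du; rewrite -[x in is_derive x](add0r x) -(scale0r (e i)).
apply/is_derive_line.
pose c := \prod_(j < d | j != i) u j (x ord0 j).
have -> : (fun t : R => tensor u (t *: e i + x)) =
    (fun t => c * u i (t + x ord0 i)).
  apply/funext => t; rewrite /tensor (bigD1 i)//= mulrC; congr (_ * _); last first.
    by rewrite !mxE eqxx eqxx mulr1.
  apply: eq_bigr => j ji; congr (u j _).
  by rewrite !mxE (negbTE ji) andbF mulr0 add0r.
have -> : tensor (tensor_diff u i) x = c *: (u i)^`()%classic (x ord0 i).
  rewrite scaleRE /tensor (bigD1 i)//= mulrC; congr (_ * _); last first.
    by rewrite /tensor_diff eqxx.
  by apply: eq_bigr => j ji; rewrite /tensor_diff (negbTE ji).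
apply: (@is_deriveZ _ _ _ (fun t => u i (t + x ord0 i)) c).
have dui : is_derive (x ord0 i) 1 (u i) ((u i)^`()%classic (x ord0 i)).
  by rewrite derive1E; apply: derivableP.
have := (is_derive_line (u i) (x ord0 i) 1 0 ((u i)^`()%classic (x ord0 i))).1.
rewrite scale0r add0r => /(_ dui).
rewrite (_ : (fun t : R => u i (t *: 1 + _)) = fun t => u i (t + x ord0 i))//.
by apply/funext => t; rewrite scaleRE mulr1.
Qed.

Lemma continuous_prodr (I : Type) (s : seq I) (F : I -> 'rV[R]_d -> R) :
  (forall i, continuous (F i)) -> continuous (fun x => \prod_(i <- s) F i x).
Proof.
move=> cF; elim: s => [|i s IH].
  rewrite (_ : (fun x => _) = fun=> 1); first exact: cst_continuous.
  by apply/funext => x; rewrite big_nil.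
rewrite (_ : (fun x => _) = fun x => F i x * \prod_(j <- s) F j x).
  by move=> x; exact: (cvgM (cF i x) (IH x)).
by apply/funext => x; rewrite big_cons.
Qed.

Lemma continuous_sumr (I : Type) (s : seq I) (F : I -> 'rV[R]_d -> R) :
  (forall i, continuous (F i)) -> continuous (fun x => \sum_(i <- s) F i x).
Proof.
move=> cF; elim: s => [|i s IH].
  rewrite (_ : (fun x => _) = fun=> 0); first exact: cst_continuous.
  by apply/funext => x; rewrite big_nil.
rewrite (_ : (fun x => _) = fun x => F i x + \sum_(j <- s) F j x).
  by move=> x; exact: (cvgD (cF i x) (IH x)).
by apply/funext => x; rewrite big_cons.
Qed.

Lemma is_derive_sumr (I : Type) (s : seq I) (F : I -> 'rV[R]_d -> R)
    (dF : I -> R) x v :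
  (forall i, is_derive x v (F i) (dF i)) ->
  is_derive x v (fun x => \sum_(i <- s) F i x) (\sum_(i <- s) dF i).
Proof.
move=> hF; elim: s => [|i s IH].
  rewrite big_nil (_ : (fun x => _) = fun=> 0); first exact: is_derive_cst.
  by apply/funext => y; rewrite big_nil.
rewrite big_cons (_ : (fun x => _) = F i + fun x => \sum_(j <- s) F j x).
  exact: is_deriveD (hF i) IH.
by apply/funext => y; rewrite big_cons.
Qed.

Lemma continuous_tensor u : (forall i y, derivable (u i) y 1) ->
  continuous (tensor u).
Proof.
move=> du; apply: continuous_prodr => i x.
apply: (@continuous_comp _ _ _ (fun x : 'rV[R]_d => x ord0 i) (u i)).
  exact: coord_continuous.
exact/differentiable_continuous/derivable1_diffP.
Qed.

Lemma smooth_tensor_sum (I : Type) (s : seq I) (c : I -> R)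
    (u : I -> 'I_d -> R -> R) : (forall a i, smooth1 (u a i)) ->
  smooth (fun x => \sum_(a <- s) c a * tensor (u a) x).
Proof.
move=> su n; have du a i y : smooth1 (u a i) -> derivable (u a i) y 1.
  by move=> /(_ 1%N)[].
have cu : (forall a i, smooth1 (u a i)) -> continuous (fun x => \sum_(a <- s) c a * tensor (u a) x).
  move=> {}su; apply: continuous_sumr => a x.
  have ct := continuous_tensor (fun i y => du a i y (su a i)).
  exact: (cvgM (cvg_cst (c a)) (ct x)).
elim: n u su du cu => [|n IH] u su du cu; first exact: cu.
split=> [|i]; first exact: cu.
have D x : is_derive x (e i) (fun x => \sum_(a <- s) c a * tensor (u a) x)
    (\sum_(a <- s) c a * tensor (tensor_diff (u a) i) x).
  apply: is_derive_sumr => a.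
  apply: (@is_deriveZ _ _ _ (tensor (u a)) (c a)).
  by apply: is_derive_tensor => y; exact: du.
split=> [x|]; first by have [] := D x.
have -> : (fun x => 'D_(delta_mx ord0 i) (fun x0 => \sum_(a <- s) c a * tensor (u a) x0) x) =
   (fun x => \sum_(a <- s) c a * tensor (tensor_diff (u a) i) x).
  by apply/funext => x; rewrite (@derive_val _ _ _ _ _ _ _ (D x)).
have su' a j : smooth1 (tensor_diff (u a) i j).
  rewrite /tensor_diff; case: ifP => _; last exact: su.
  by move=> m; have [] := su a i m.+1.
have du' a j y : smooth1 (tensor_diff (u a) i j) -> derivable (tensor_diff (u a) i j) y 1.
  by move=> /(_ 1%N)[].
apply: IH => //.
move=> _; apply: continuous_sumr => a x.
have ct := continuous_tensor (fun j y => du' a j y (su' a j)).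
exact: (cvgM (cvg_cst (c a)) (ct x)).
Qed.

Lemma smooth_tensor u : (forall i, smooth1 (u i)) -> smooth (tensor u).
Proof.
move=> su; rewrite (_ : tensor u = fun x => \sum_(a <- [:: tt]) 1 * tensor u x).
  exact: (@smooth_tensor_sum _ [:: tt] (fun=> 1) (fun=> u)).
by apply/funext => x; rewrite big_seq1 mul1r.
Qed.

Lemma smooth_continuous g : smooth g -> continuous g.
Proof. by move=> /(_ 0%N). Qed.

Lemma smooth_derivable g i x : smooth g -> derivable g x (e i).
Proof. by move=> /(_ 1%N)[_ /(_ i)[]]. Qed.

Lemma smooth_derive g i : smooth g -> smooth (fun x => 'D_(e i) g x).
Proof. by move=> sg n; have [_ /(_ i)[]] := sg n.+1. Qed.

End SmoothFunctionsOfSeveralVariables.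

(** * Taylor approximation on cubes *)

Section TaylorOneVariable.
Variable R : realType.

Definition taylor_poly (n : nat) (c : nat -> R) : {poly R} :=
  \poly_(l < n) (c l / l`!%:R).

Lemma deriv_taylor_poly n c :
  deriv (taylor_poly n.+1 c) = taylor_poly n (fun l => c l.+1).
Proof.
apply/polyP => l; rewrite coef_deriv !coef_poly ltnS.
case: ifP => _; last by rewrite mul0rn.
rewrite -[X in X *+ _]mulr1 -mulrnAr -mulrA; congr (_ * _).
rewrite factS natrM invfM -[l.+1%:R^-1 * _ ]mulrC mulrnAr mulr1 -mulr_natr -mulrA.
by rewrite mulVf ?mulr1// pnatr_eq0.
Qed.

(** The remainder of order n+1 of D 0 has the remainder of order n of D 1 as its
    derivative, so the mean value theorem gives the bound by induction. *)
Lemma taylor_remainder n (D : nat -> R -> R) (a t M : R) :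
  (forall l (s : R), is_derive s 1 (D l) (D l.+1 s)) -> a <= t ->
  (forall s, a <= s <= t -> `|D n s| <= M) ->
  `|D 0%N t - (taylor_poly n (D^~ a)).[t - a]| <= M * (t - a) ^+ n.
Proof.
elim: n D t => [|n IH] D t dD at_ HM.
  have -> : taylor_poly 0 (D^~ a) = 0 by rewrite /taylor_poly poly_def big_ord0.
  by rewrite horner0 subr0 expr0 mulr1 HM// at_ lexx.
pose Rm s := D 0%N s - (taylor_poly n.+1 (D^~ a)).[s - a].
pose Rm' s := D 1%N s - (taylor_poly n (fun l => D l.+1 a)).[s - a].
have dRm (s : R) : is_derive s 1 Rm (Rm' s).
  have ds : is_derive s 1 (fun s : R => s - a) (1 : R).
    by have := is_deriveB (is_derive_id s (1 : R)) (is_derive_cst a s 1); rewrite subr0.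
  have := @is_derive1_comp _ (horner (taylor_poly n.+1 (D^~ a)))
    (fun s => s - a) _ _ _
    (is_derive_poly _ (s - a)) ds.
  rewrite mulr1 deriv_taylor_poly => dp.
  exact: (is_deriveB (dD 0%N s) dp).
have [s /itvP sat] : exists2 c, c \in `[a, t]%R & Rm t - Rm a = Rm' c * (t - a).
  apply: MVT_segment => //.
  apply: derivable_within_continuous => s _.
  by have [] := dRm s.
have -> : Rm a = 0.
  rewrite /Rm subrr horner_coef0 coef_poly/= fact0 divr1 subrr//.
rewrite subr0 /Rm => ->; rewrite normrM (ger0_norm (_ : 0 <= t - a)) ?subr_ge0//.
rewrite exprSr mulrA ler_wpM2r ?subr_ge0//.
have M0 : 0 <= M by apply: le_trans (HM t _) => //; rewrite at_ lexx.
apply: (@le_trans _ _ (M * (s - a) ^+ n)); last first.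
  rewrite ler_wpM2l// lerXn2r ?nnegrE ?subr_ge0 ?sat// lerD2r sat//.
apply: (IH (fun l => D l.+1)) => //; first by rewrite sat.
by move=> z /andP[az zs]; apply: HM; rewrite az (le_trans zs)// sat.
Qed.

End TaylorOneVariable.

Section TaylorSeveralVariables.
Variables (R : realType) (d : nat).
Implicit Types (g : 'rV[R]_d -> R) (x y a : 'rV[R]_d) (r M : R).

Let e (i : 'I_d) : 'rV[R]_d := delta_mx ord0 i.

Definition box a r : set 'rV[R]_d :=
  [set x | forall i, a ord0 i <= x ord0 i <= a ord0 i + r].

Fixpoint partials (s : seq 'I_d) g : 'rV[R]_d -> R :=
  if s is i :: s' then partials s' (fun x => 'D_(e i) g x) else g.

Lemma partials_cat s s' g : partials (s ++ s') g = partials s' (partials s g).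
Proof. by elim: s g => [//|i s IH] g /=. Qed.

Lemma smooth_partials s g : smooth g -> smooth (partials s g).
Proof.
elim: s g => [//|i s IH] g sg /=; apply: IH; exact: smooth_derive.
Qed.

Lemma is_derive_partials i l g x (t : R) : smooth g ->
  is_derive t 1 (fun t : R => partials (nseq l i) g (t *: e i + x))
                (partials (nseq l.+1 i) g (t *: e i + x)).
Proof.
move=> sg; have -> y : partials (nseq l.+1 i) g y = 'D_(e i) (partials (nseq l i) g) y.
  by rewrite -addn1 nseqD partials_cat.
apply: (is_derive_line (partials (nseq l i) g) x (e i) t _).1.
by apply: derivableP; apply: smooth_derivable; exact: smooth_partials.
Qed.

(** Taylor expansion one coordinate at a time: expand in the first coordinate of
    L, then expand every coefficient in the remaining ones. Working in a fixed
    order avoids the symmetry of mixed partial derivatives. The approximant must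
    not depend on the coordinates outside L, because the coefficients are
    approximated on the slice where the first coordinate is that of a. *)
Lemma taylor_box (L : seq 'I_d) g n M a r : uniq L -> smooth g -> 0 <= r -> 0 <= M ->
  (forall s, size s = n -> forall y, box a r y -> `|partials s g y| <= M) ->
  exists q, [/\ is_poly n q,
    forall x y, (forall i, i \in L -> x ord0 i = y ord0 i) -> q x = q y &
    forall x, box a r x -> (forall i, i \notin L -> x ord0 i = a ord0 i) ->
      `|g x - q x| <= n.+1%:R ^+ size L * M * r ^+ n].
Proof.
elim: L g n => [|i L IH] g n /=; [move=> _|move=> /andP[iL uL]] => sg r0 M0 HM.
  case: n HM => [|n] HM.
    exists (fun=> 0); split=> //; first exact: is_poly0.
    by move=> x bx _; rewrite subr0 !expr0 mulr1 mul1r; exact: (HM [::]).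
  exists (fun=> g a); split=> //; first exact: is_poly_cst.
  move=> x bx xa; rewrite (_ : x = a); last by apply/rowP => i; exact: xa.
  by rewrite subrr normr0 expr0 mul1r mulr_ge0 ?exprn_ge0.
have /choice[q Hq] (l : 'I_n) : exists q, [/\ is_poly (n - l) q,
    forall x y, (forall i, i \in L -> x ord0 i = y ord0 i) -> q x = q y &
    forall x, box a r x -> (forall i, i \notin L -> x ord0 i = a ord0 i) ->
      `|partials (nseq l i) g x - q x| <=
        (n - l).+1%:R ^+ size L * M * r ^+ (n - l)].
  apply: IH => //; first exact: smooth_partials.
  move=> s sn y by_; rewrite -partials_cat; apply: HM => //.
  by rewrite size_cat size_nseq sn subnKC// ltnW.
exists (fun x => \sum_(l < n) (l`!%:R^-1 * (x ord0 i - a ord0 i) ^+ l) * q l x).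
split.
- apply: is_poly_sum => l; have [ql _ _] := Hq l.
  rewrite [X in is_poly X](_ : _ = (1 * l + (n - l).-1).+1); last first.
    by have := ltn_ord l; lia.
  apply: is_polyM.
    apply/is_polyZ/is_polyX/is_polyB; first exact: is_poly_coord.
    exact: is_poly_cst.
  by rewrite prednK// subn_gt0.
- move=> x y xy; apply: eq_bigr => l _; have [_ ql _] := Hq l.
  rewrite xy ?mem_head// (ql _ y)// => j jL; apply: xy.
  by rewrite inE jL orbT.
move=> x bx xa.
pose t := x ord0 i; pose x' : 'rV[R]_d := x - t *: e i.
have xE : x = t *: e i + x' by rewrite addrC subrK.
have coordE s j : (s *: e i + x') ord0 j = if j == i then s else x ord0 j.
  rewrite !mxE eqxx /=; case: eqP => [->|_] /=; first by rewrite mulr1 /t; ring.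
  by rewrite !mulr0 add0r subr0.
have bs s : a ord0 i <= s <= t -> box a r (s *: e i + x').
  move=> /andP[as_ st] j; rewrite coordE; case: eqP => [->|_]; last exact: bx.
  by rewrite as_ (le_trans st)//; have /andP[] := bx i.
have /andP[at_ tar] := bx i; rewrite -/t in at_ tar.
set z := a ord0 i *: e i + x'.
have bz : box a r z by apply: bs; rewrite lexx.
have zL j : j \notin L -> z ord0 j = a ord0 j.
  move=> jL; rewrite coordE; case: eqP => [->//|/eqP ji]; apply: xa.
  by rewrite inE negb_or ji.
have T : `|g x - \sum_(l < n) (l`!%:R^-1 * (t - a ord0 i) ^+ l) * partials (nseq l i) g z|
    <= M * r ^+ n.
  have := @taylor_remainder _ n (fun l s => partials (nseq l i) g (s *: e i + x'))
    (a ord0 i) t M.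
  move=> /(_ (fun l s => is_derive_partials i l x' s sg) at_).
  have HMs s : a ord0 i <= s <= t -> `|partials (nseq n i) g (s *: e i + x')| <= M.
    by move=> sat; apply: HM; rewrite ?size_nseq//; exact: bs.
  move=> /(_ HMs); rewrite /= -xE horner_poly => h.
  apply: (le_trans (le_trans _ h)).
    by under eq_bigr do rewrite mulrC mulrA.
  by rewrite ler_wpM2l// lerXn2r ?nnegrE ?subr_ge0// lerBlDl.
have Q l : `|partials (nseq (l : 'I_n) i) g z - q l x| <= n.+1%:R ^+ size L * M * r ^+ (n - l).
  have [_ ql hl] := Hq l.
  rewrite (ql _ z); last first.
    move=> j jL; rewrite coordE; case: eqP => // ji.
    by move: iL; rewrite -ji jL.
  apply: le_trans (hl _ bz zL) _; rewrite ler_wpM2r ?exprn_ge0// ler_wpM2r//.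
  by rewrite lerXn2r ?nnegrE// ler_nat ltnS leq_subr.
rewrite -(subrK (\sum_(l < n) (l`!%:R^-1 * (t - a ord0 i) ^+ l) *
   partials (nseq l i) g z) (g x)) -addrA -sumrB.
apply: (le_trans (ler_normD _ _)).
apply: (@le_trans _ _ (M * r ^+ n + n%:R * (n.+1%:R ^+ size L * M * r ^+ n))).
  apply: lerD => //; apply: le_trans (ler_norm_sum _ _ _) _.
  rewrite -[n in n%:R]card_ord mulr_natl -sumr_const; apply: ler_sum => l _.
  rewrite -mulrBr normrM normrM ger0_norm ?invr_ge0// ger0_norm; last first.
    by rewrite exprn_ge0// subr_ge0.
  have rl : l`!%:R^-1 * (t - a ord0 i) ^+ l <= r ^+ l.
    rewrite -[leRHS]mul1r ler_pM ?invr_ge0 ?exprn_ge0 ?subr_ge0//.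
      by rewrite invf_le1 ?ltr0n ?fact_gt0// ler1n fact_gt0.
    by rewrite lerXn2r ?nnegrE ?subr_ge0// lerBlDl.
  apply: le_trans (ler_pM _ _ rl (Q l)) _ => //.
    by rewrite mulr_ge0 ?invr_ge0 ?exprn_ge0// subr_ge0.
  by rewrite mulrCA -exprD subnKC// ltnW.
rewrite !mulrA -mulrDl ler_wpM2r ?exprn_ge0// -[X in X + _]mul1r -mulrDl.
rewrite ler_wpM2r// exprS -[n.+1]add1n natrD mulrDl lerD2r mul1r.
by rewrite exprn_ege1// lerDl.
Qed.

Lemma continuous_bounded_box g a r : continuous g ->
  exists2 M, 0 <= M & forall x, box a r x -> `|g x| <= M.
Proof.
move=> cg; have [[x0 bx0]|nb] := pselect (exists x, box a r x); last first.
  by exists 0 => // x bx; case: nb; exists x.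
have cb : compact (box a r).
  rewrite (_ : box a r = [set v : 'rV[R]_d |
    forall i, `[a ord0 i, a ord0 i + r]%classic (v ord0 i)]).
    apply: (@rV_compact _ _ (fun i => `[a ord0 i, a ord0 i + r]%classic)).
    by move=> i; exact: segment_compact.
  by apply/seteqP; split=> x bx i; have := bx i; rewrite /= in_itv.
have [|c _ hc] := @EVT_max_rV _ _ (fun x => `|g x|) (box a r)
    (ex_intro _ x0 bx0) cb.
  apply: continuous_subspaceT => x.
  exact: (continuous_comp (cg x) (@norm_continuous _ R (g x))).
by exists `|g c| => // x bx; apply: hc; rewrite inE.
Qed.

(** The constant is uniform over the cubes of a bounded region because it comes
    from bounds of the partial derivatives of order n on a compact box. *)
Lemma smooth_poly_approx g n a0 r0 : smooth g ->
  exists2 C, 0 <= C & forall a r, 0 <= r -> box a r `<=` box a0 r0 ->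
    exists2 q, is_poly n q & forall x, box a r x -> `|g x - q x| <= C * r ^+ n.
Proof.
move=> sg.
have /choice[M HM] (s : n.-tuple 'I_d) : exists M, 0 <= M /\
    forall x, box a0 r0 x -> `|partials s g x| <= M.
  have [M M0 HM] := @continuous_bounded_box (partials s g) a0 r0
    (smooth_continuous (smooth_partials _ sg)).
  by exists M.
pose Mx := \sum_s M s.
have Mx0 : 0 <= Mx by apply: sumr_ge0 => s _; have [] := HM s.
exists (n.+1%:R ^+ d * Mx); first by rewrite mulr_ge0.
move=> a r r_ge0 sub.
have [|q [qn _ hq]] := @taylor_box (enum 'I_d) g n Mx a r (enum_uniq _) sg r_ge0 Mx0.
  move=> s /eqP sn y bxy; apply: (@le_trans _ _ (M (Tuple sn))).
    by have [_] := HM (Tuple sn); apply; exact: sub.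
  rewrite /Mx (bigD1 (Tuple sn))//= lerDl; apply: sumr_ge0 => s' _.
  by have [] := HM s'.
exists q => // x bx; have := hq x bx; rewrite size_enum_ord; apply.
by move=> i; rewrite mem_enum.
Qed.

End TaylorSeveralVariables.

(** * Total volume of non-overlapping cubes *)

Section Volume.
Variables (R : realType) (d : nat).
Implicit Types (a x : 'rV[R]_d) (r : R).

Definition obox a r : set 'rV[R]_d :=
  [set x | forall i, a ord0 i < x ord0 i < a ord0 i + r].

(** An open interval of length l contains more than M l - 2 points of a grid of step
    1/M, hence at least M l / 2 of them as soon as M l >= 4. *)
Lemma count_grid_points (M : nat) (lo len b B : R) :
  4 <= M%:R * len -> 0 < M%:R :> R -> b <= lo -> lo + len <= b + B ->
  M%:R * len / 2 <=
  #|[pred v : 'I_(Num.truncn (M%:R * B)).+1 | lo < b + v%:R / M%:R < lo + len]|%:R.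
Proof.
have aux (m t : nat) : (t < m.-1 -> 3 < m -> t + 2 <= m)%N by lia.
move=> Ml M0 blo lenB; set K := Num.truncn (M%:R * B).
have lolen : M%:R * (lo - b) + M%:R * len <= M%:R * B.
  by rewrite -mulrDr ler_wpM2l// ?(ltW M0)//; lra.
have lob : 0 <= M%:R * (lo - b) by rewrite mulr_ge0 ?subr_ge0// ltW.
set u := Num.truncn (M%:R * (lo - b)).
set n := Num.truncn (M%:R * len).
have /andP[u1 u2] : u%:R <= M%:R * (lo - b) < u.+1%:R by exact: truncn_itv.
have /andP[n1 n2] : n%:R <= M%:R * len < n.+1%:R by apply: truncn_itv; lra.
have /andP[K1 K2] : K%:R <= M%:R * B < K.+1%:R by apply: truncn_itv; lra.
have n4 : (3 < n)%N by rewrite -ltnS -(ltr_nat R) (le_lt_trans Ml).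
clearbody K u n.
have vE (t : 'I_n.-1) : M%:R * (lo - b) < (u + 1 + t)%:R < M%:R * (lo - b) + M%:R * len.
  have tn : (t + 2 <= n)%N := aux _ _ (ltn_ord t) n4.
  have : t%:R + 2 <= n%:R :> R by rewrite -natrD ler_nat.
  have t0 : 0 <= t%:R :> R by [].
  by rewrite -natr1 in u2; rewrite !natrD; lra.
have vK (t : 'I_n.-1) : (u + 1 + t < K.+1)%N.
  by rewrite -(ltr_nat R) (le_lt_trans _ K2)//; have /andP[_ /ltW/le_trans] := vE t; apply.
pose h (t : 'I_n.-1) : 'I_K.+1 := inord (u + 1 + t).
have hinj : injective h.
  move=> t t' /(congr1 val); rewrite /= !inordK// => /addnI tt'; exact: val_inj.
apply: (@le_trans _ _ n.-1%:R).
  have : n.-1%:R = n%:R - 1 :> R by rewrite -subn1 natrB// (leq_trans _ n4).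
  by rewrite -natr1 in n2; lra.
rewrite ler_nat -[n.-1]card_ord -(fintype.card_image hinj).
apply: subset_leq_card; apply/fintype.subsetP => _ /fintype.imageP[t _ ->].
have /andP[v1 v2] := vE t.
have hE : nat_of_ord (h t) = (u + 1 + t)%N by exact: inordK.
rewrite inE hE; move: (u + 1 + t)%N v1 v2 => w v1 v2.
have wE : M%:R * (w%:R / M%:R) = w%:R :> R by rewrite mulrCA divff ?mulr1 ?gt_eqF.
rewrite mulrBr in v1 v2.
by apply/andP; split; rewrite -(ltr_pM2l M0) [M%:R * (b + _)]mulrDr wE; lra.
Qed.

(** Compare the numbers of points of a fine grid inside the cubes and inside the
    box. The factor 4 pays for the grid points lost or gained at the boundaries,
    which makes a passage to the limit unnecessary. *)
Lemma volume_le (T : eqType) (s : seq T) (a : T -> 'rV[R]_d) (r : T -> R)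
    (b : 'rV[R]_d) (B : R) : 0 < B -> uniq s ->
  (forall Q, Q \in s -> 0 < r Q /\ forall i,
     b ord0 i <= a Q ord0 i /\ a Q ord0 i + r Q <= b ord0 i + B) ->
  (forall Q Q', Q \in s -> Q' \in s -> Q != Q' ->
     forall x, obox (a Q) (r Q) x -> ~ obox (a Q') (r Q') x) ->
  \sum_(Q <- s) r Q ^+ d <= (4 * B) ^+ d.
Proof.
move=> B0 us hs dis.
have [M [M0 MB Mr]] : exists M : nat, [/\ 0 < M%:R :> R, 1 <= M%:R * B &
    forall Q, Q \in s -> 4 <= M%:R * r Q].
  pose m := 1 + B^-1 + \sum_(Q <- s) `|4 / r Q|.
  have m0 : 0 < m.
    by rewrite ltr_wpDr ?sumr_ge0// addr_gt0 ?invr_gt0.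
  have mM : m < (Num.truncn m).+1%:R by rewrite truncnS_gt.
  exists (Num.truncn m).+1; split=> //.
    rewrite -ler_pdivrMr// mul1r (le_trans _ (ltW mM))// /m.
    have : 0 <= \sum_(Q <- s) `|4 / r Q| by rewrite sumr_ge0.
    by lra.
  move=> Q Qs; have [rQ _] := hs _ Qs; rewrite -ler_pdivrMr// (le_trans _ (ltW mM))//.
  rewrite /m (big_rem Q)//= (le_trans (ler_norm _))//.
  have : 0 <= \sum_(y <- rem Q s) `|4 / r y| by rewrite sumr_ge0.
  have : 0 < B^-1 by rewrite invr_gt0.
  by lra.
set K := Num.truncn (M%:R * B).
have /andP[K1 K2] : K%:R <= M%:R * B < K.+1%:R by apply: truncn_itv; lra.
pose S Q (i : 'I_d) := [pred v : 'I_K.+1 | a Q ord0 i < b ord0 i + v%:R / M%:R < a Q ord0 i + r Q].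
have cS Q : Q \in s -> (M%:R * r Q / 2) ^+ d <= #|family (S Q)|%:R.
  move=> Qs; have [rQ abQ] := hs _ Qs.
  rewrite card_family foldrE big_map big_enum/= natr_prod.
  rewrite -[in X in X <= _](card_ord d) -prodr_const; apply: ler_prod => i _.
  rewrite !mulr_ge0 ?(ltW M0) ?(ltW rQ)//=.
  have [b1 b2] := abQ i.
  exact: count_grid_points (Mr _ Qs) M0 b1 b2.
have tot : (\sum_(Q <- s) #|family (S Q)| <= K.+1 ^ d)%N.
  under eq_bigr do rewrite -sum1_card big_mkcond/=.
  rewrite exchange_big/=.
  apply: (@leq_trans (\sum_(v : {ffun 'I_d -> 'I_K.+1}) 1)%N); last first.
    by rewrite sum1_card card_ffun !card_ord.
  apply: leq_sum => v _; rewrite -big_mkcond sum1_count.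
  have [/hasP[Q0 Q0s vQ0]|] := boolP (has (fun Q => v \in family (S Q)) s); last first.
    by rewrite has_count -leqNgt => /leq_trans; apply.
  rewrite (@eq_in_count _ _ (pred1 Q0)) ?count_uniq_mem ?Q0s// => Q Qs /=.
  apply/idP/eqP => [vQ|->//]; apply/eqP; apply: contraT => QQ0.
  pose x : 'rV[R]_d := \row_i (b ord0 i + (v i)%:R / M%:R).
  have xv Q' : v \in family (S Q') -> obox (a Q') (r Q') x.
    by move=> /familyP h i; rewrite mxE; exact: h.
  by have := dis _ _ Qs Q0s QQ0 x (xv _ vQ) (xv _ vQ0).
have M2 : 0 < (M%:R / 2) ^+ d :> R by rewrite exprn_gt0// divr_gt0.
rewrite -(ler_pM2l M2) mulr_sumr -exprMn.
apply: (@le_trans _ _ (\sum_(Q <- s) #|family (S Q)|%:R)).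
  rewrite big_seq [leRHS]big_seq; apply: ler_sum => Q Qs.
  by rewrite -exprMn mulrAC; exact: cS.
apply: (@le_trans _ _ (K.+1 ^ d)%:R); first by rewrite -natr_sum ler_nat.
rewrite natrX lerXn2r ?nnegrE//; first by rewrite !mulr_ge0 ?(ltW M0) ?(ltW B0).
by rewrite -natr1; nra.
Qed.

End Volume.

(** * Best approximation and packings *)

Section BestApproximation.
Variables (R : realType) (d k : nat).
Implicit Types (f g q : 'rV[R]_d -> R) (A : set 'rV[R]_d) (c : R).

Lemma best_approx_le f q A c : is_poly k q ->
  (forall x, A x -> `|f x - q x| <= c) -> (best_approx k f A <= c%:E)%E.
Proof.
move=> [m mk mq] H; apply: (@le_trans _ _ (ereal_sup [set `|f x - poly_fun m x|%:E | x in A])).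
  by apply: ereal_inf_lbound; exists m.
by apply: ge_ereal_sup => _ [x Ax <-]; rewrite lee_fin -mq H.
Qed.

Lemma best_approx_lt f A c : (best_approx k f A < c%:E)%E ->
  exists2 q, is_poly k q & forall x, A x -> `|f x - q x| <= c.
Proof.
move=> /ereal_inf_lt[_ [m mk <-] h]; exists (poly_fun m); first by exists m.
move=> x Ax; rewrite -lee_fin (le_trans _ (ltW h))//.
by apply: ereal_sup_ubound; exists x.
Qed.

Lemma best_approx_ge0 f A : A !=set0 -> (0 <= best_approx k f A)%E.
Proof.
move=> [x Ax]; apply: le_ereal_inf_tmp => _ [m mk <-].
by apply: le_trans (ereal_sup_ubound _); last by exists x.
Qed.

(** The best approximation is finite for bounded functions, and then it is more
    convenient as a real number. *)
Definition err f A : R := fine (best_approx k f A).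

Definition bounded_on f A := exists B, forall x, A x -> `|f x| <= B.

Lemma errE f A : A !=set0 -> bounded_on f A ->
  best_approx k f A = (err f A)%:E.
Proof.
move=> A0 [B HB]; rewrite /err fineK// fin_real//.
rewrite (lt_le_trans _ (best_approx_ge0 _ A0))//=.
apply: le_lt_trans (best_approx_le (is_poly0 _ _ k) _) (ltry B).
by move=> x Ax; rewrite subr0 HB.
Qed.

Lemma err_ge0 f A : A !=set0 -> 0 <= err f A.
Proof. by move=> A0; apply/fine_ge0/best_approx_ge0. Qed.

Lemma err_le f q A c : A !=set0 -> bounded_on f A -> is_poly k q ->
  (forall x, A x -> `|f x - q x| <= c) -> err f A <= c.
Proof. by move=> A0 fA kq H; rewrite -lee_fin -errE//; exact: best_approx_le H. Qed.

Lemma err_lt f A c : A !=set0 -> bounded_on f A -> err f A < c ->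
  exists2 q, is_poly k q & forall x, A x -> `|f x - q x| <= c.
Proof. by move=> A0 fA; rewrite -lte_fin -errE//; exact: best_approx_lt. Qed.

Lemma bounded_onB f g A : bounded_on f A -> bounded_on g A ->
  bounded_on (fun x => f x - g x) A.
Proof.
move=> [B HB] [B' HB']; exists (B + B') => x Ax.
by rewrite (le_trans (ler_normB _ _))// lerD ?HB ?HB'.
Qed.

Lemma err_triangle f g A : A !=set0 -> bounded_on f A -> bounded_on g A ->
  err f A <= err (fun x => f x - g x) A + err g A.
Proof.
move=> A0 fA gA; apply/ler_addgt0Pr => e e0.
have fgA := bounded_onB fA gA.
have [q kq hq] : exists2 q, is_poly k q &
    forall x, A x -> `|(f x - g x) - q x| <= err (fun x => f x - g x) A + e / 2.
  by apply: err_lt => //; rewrite ltrDl divr_gt0.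
have [q' kq' hq'] : exists2 q, is_poly k q &
    forall x, A x -> `|g x - q x| <= err g A + e / 2.
  by apply: err_lt => //; rewrite ltrDl divr_gt0.
apply: (err_le A0 fA (is_polyD kq kq')) => x Ax.
have -> : f x - (q x + q' x) = ((f x - g x) - q x) + (g x - q' x) by ring.
rewrite (le_trans (ler_normD _ _))//.
by have := hq x Ax; have := hq' x Ax; lra.
Qed.

Lemma err_diff_le f g A : A !=set0 -> bounded_on f A -> bounded_on g A ->
  err (fun x => f x - g x) A <= err f A + err g A.
Proof.
move=> A0 fA gA; apply/ler_addgt0Pr => e e0.
have fgA := bounded_onB fA gA.
have [q kq hq] : exists2 q, is_poly k q &
    forall x, A x -> `|f x - q x| <= err f A + e / 2.
  by apply: err_lt => //; rewrite ltrDl divr_gt0.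
have [q' kq' hq'] : exists2 q, is_poly k q &
    forall x, A x -> `|g x - q x| <= err g A + e / 2.
  by apply: err_lt => //; rewrite ltrDl divr_gt0.
apply: (err_le A0 fgA (is_polyB kq kq')) => x Ax.
have -> : f x - g x - (q x - q' x) = (f x - q x) - (g x - q' x) by ring.
rewrite (le_trans (ler_normB _ _))//.
by have := hq x Ax; have := hq' x Ax; lra.
Qed.

End BestApproximation.

Section Packings.
Variables (R : realType) (d : nat).
Implicit Types (Q : 'rV[R]_d * R) (s : seq ('rV[R]_d * R)).

Lemma cube_setE Q : 0 < Q.2 -> cube_set Q = box Q.1 Q.2.
Proof.
case: Q => a r /= r0; apply/seteqP; split=> [_ [x ux <-]|x bx] /=.
  move=> i; rewrite !mxE lerDl lerD2l; have /andP[x0 x1] := ux i.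
  by rewrite mulr_ge0 ?(ltW r0)// ler_piMr// ltW.
exists (r^-1 *: (x - a)); last by rewrite scalerA divff ?gt_eqF// scale1r addrC subrK.
move=> i; rewrite !mxE mulr_ge0 ?invr_ge0 ?(ltW r0)//=; last first.
  by rewrite subr_ge0; have /andP[] := bx i.
by rewrite mulrC ler_pdivrMr// mul1r lerBlDl; have /andP[] := bx i.
Qed.

Lemma unit_cubeE : unit_cube R d = box 0 1.
Proof. by apply/seteqP; split=> x ux i; have := ux i; rewrite !mxE add0r. Qed.

(** Moving a point of the interior slightly along each coordinate axis shows that
    the defining inequalities are strict. *)
Lemma interior_cube_set Q : 0 < Q.2 ->
  interior (cube_set Q) = obox Q.1 Q.2.
Proof.
move=> r0; rewrite cube_setE//; case: Q r0 => a r /= r0.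
apply/seteqP; split=> x.
  move=> /nbhs_ballP[e /= e0 xe] i.
  have h (t : R) : `|t| < e -> a ord0 i <= x ord0 i + t <= a ord0 i + r.
    move=> te; have : ball x e (x + t *: delta_mx ord0 i).
      split=> // i' j; rewrite !mxE /ball /= opprD addrA subrr sub0r normrN normrM.
      apply: le_lt_trans te; rewrite ler_piMr//.
      by case: (_ && _); rewrite ?normr1 ?normr0.
    by move=> /xe/(_ i); rewrite !mxE !eqxx mulr1.
  have he : `|e / 2| < e by rewrite ger0_norm; lra.
  have he' : `|- (e / 2)| < e by rewrite normrN.
  by have := h _ he; have := h _ he'; lra.
move=> ox; apply/nbhs_ballP.
pose e := \big[Num.min/1]_(i < d)
  Num.min (x ord0 i - a ord0 i) (a ord0 i + r - x ord0 i).
exists e => /=.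
  rewrite /e; elim/big_ind: _ => [|u v u0 v0|i _]//; first by rewrite lt_min u0.
  by rewrite lt_min !subr_gt0; have /andP[-> ->] := ox i.
move=> y [_ xy] i.
have ei : e <= Num.min (x ord0 i - a ord0 i) (a ord0 i + r - x ord0 i).
  by apply: bigmin_le_cond.
have := lt_le_trans (xy ord0 i) ei.
by rewrite lt_min !ltr_norml; lra.
Qed.

(** Packings given by lists, so that sums over a packing are ordinary iterated
    sums, and with the interiors replaced by open boxes. *)
Definition seq_packing s := [/\ uniq s,
  forall Q, Q \in s -> 0 < Q.2 /\ cube_set Q `<=` unit_cube R d &
  forall Q Q', Q \in s -> Q' \in s -> Q != Q' ->
    forall x, obox Q.1 Q.2 x -> ~ obox Q'.1 Q'.2 x].

Lemma packing_seqP pi : packing pi -> exists2 s, seq_packing s & pi = [set` s].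
Proof.
move=> [/finite_seqP[s piE] cpi tpi]; exists (undup s); last first.
  by rewrite piE; apply/seteqP; split=> Q; rewrite /= mem_undup.
have mem Q : Q \in undup s -> pi Q by rewrite piE mem_undup.
split; [exact: undup_uniq|by move=> Q /mem/cpi|].
move=> Q Q' /mem piQ /mem piQ' QQ' x xQ xQ'.
have [[Q0 _] [Q'0 _]] := (cpi _ piQ, cpi _ piQ').
move/eqP: QQ'; apply; apply: tpi => //.
by exists x; rewrite !interior_cube_set.
Qed.

Lemma seq_packingP s : seq_packing s -> packing [set` s].
Proof.
move=> [us cs ds]; split; [exact: finite_seq|by move=> Q /= /cs|].
move=> Q Q' /= sQ sQ' [x []].
have [[Q0 _] [Q'0 _]] := (cs _ sQ, cs _ sQ').
rewrite !interior_cube_set// => xQ xQ'; apply/eqP; apply: contraT => QQ'.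
by have := ds _ _ sQ sQ' QQ' x xQ xQ'.
Qed.

Lemma seq_packing_filter (P : pred ('rV[R]_d * R)) s :
  seq_packing s -> seq_packing [seq Q <- s | P Q].
Proof.
move=> [us cs ds]; split; first exact: filter_uniq.
  by move=> Q; rewrite mem_filter => /andP[_ /cs].
by move=> Q Q'; rewrite !mem_filter => /andP[_ sQ] /andP[_ sQ']; exact: ds.
Qed.

Lemma mesh_le s (eps : R) :
  (mesh [set` s] <= eps%:E)%E <-> forall Q, Q \in s -> Q.2 ^+ d <= eps.
Proof.
split=> [h Q Qs|h].
  by rewrite -lee_fin (le_trans _ h)//; apply: ereal_sup_ubound; exists Q.
by apply: ge_ereal_sup => _ [Q Qs <-]; rewrite lee_fin; exact: h.
Qed.

Lemma cube_set_neq0 Q : 0 < Q.2 -> cube_set Q !=set0.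
Proof. by move=> r0; exists Q.1; rewrite cube_setE// => i; rewrite lexx lerDl ltW. Qed.

Lemma box_sub (a b : 'rV[R]_d) (r B : R) : 0 <= r -> box a r `<=` box b B ->
  forall i, b ord0 i <= a ord0 i /\ a ord0 i + r <= b ord0 i + B.
Proof.
move=> r0 sub i.
have h0 : box a r a by move=> j; rewrite lexx lerDl.
have h1 : box a r (a + const_mx r) by move=> j; rewrite !mxE lexx lerDl r0.
by have := sub _ h0 i; have := sub _ h1 i; rewrite !mxE; lra.
Qed.

Lemma packing_box s Q : seq_packing s -> Q \in s -> box Q.1 Q.2 `<=` box 0 1.
Proof. by move=> [_ cs _] /cs[Q0]; rewrite cube_setE// unit_cubeE. Qed.

Lemma volume_packing s : seq_packing s -> \sum_(Q <- s) Q.2 ^+ d <= 4 ^+ d.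
Proof.
move=> ps; have [us cs ds] := ps; rewrite -[X in X ^+ d]mulr1.
apply: (@volume_le _ _ _ s fst snd 0) => // Q Qs.
have [Q0 _] := cs _ Qs; split=> //; exact: box_sub (ltW Q0) (packing_box ps Qs).
Qed.

End Packings.

Section Variation.
Variables (R : realType) (d k : nat) (p : R).
Hypothesis hp : 1 <= p.
Implicit Types (f g : 'rV[R]_d -> R) (s : seq ('rV[R]_d * R)).

Let p0 : 0 < p. Proof. exact: lt_le_trans hp. Qed.

Definition var_sum f s := \sum_(Q <- s) err k f (cube_set Q) `^ p.

Lemma var_sum_ge0 f s : 0 <= var_sum f s.
Proof. by apply: sumr_ge0 => Q _; exact: powR_ge0. Qed.

Lemma bounded_on_cube f s Q : bounded_on f (unit_cube R d) -> seq_packing s ->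
  Q \in s -> bounded_on f (cube_set Q).
Proof.
by move=> [B HB] [_ cs _] /cs[_ sub]; exists B => x /sub; exact: HB.
Qed.

Lemma packing_varE f s : bounded_on f (unit_cube R d) -> seq_packing s ->
  packing_var k p f [set` s] = (var_sum f s `^ p^-1)%:E.
Proof.
move=> fb ps; have [us cs _] := ps.
rewrite /packing_var -fsbig_seq// -poweR_EFin; congr (_ `^ _)%E.
rewrite /var_sum -sumEFin big_seq [RHS]big_seq; apply: eq_bigr => Q Qs.
rewrite (errE k (cube_set_neq0 (cs _ Qs).1) (bounded_on_cube fb ps Qs)).
by rewrite poweR_EFin.
Qed.

Lemma root_le_iff (u c : R) : 0 <= u -> 0 <= c -> (u `^ p^-1 <= c) = (u <= c `^ p).
Proof.
move=> u0 c0.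
have up : u = (u `^ p^-1) `^ p by rewrite -powRrM mulVf ?gt_eqF// powRr1.
rewrite [in RHS]up; apply/idP/idP => h.
  by rewrite ge0_ler_powR ?nnegrE ?powR_ge0// ltW.
rewrite leNgt; apply/negP => ch; move: h; apply/negP; rewrite -ltNge.
by rewrite gt0_ltr_powR ?nnegrE ?powR_ge0.
Qed.

Lemma V_seminorm_le f c : bounded_on f (unit_cube R d) -> 0 <= c ->
  (V_seminorm k p f <= c%:E)%E <->
  forall s, seq_packing s -> var_sum f s <= c `^ p.
Proof.
move=> fb c0; split=> [h s ps|h].
  rewrite -root_le_iff// ?var_sum_ge0// -lee_fin -packing_varE//.
  apply: le_trans h; apply: ereal_sup_ubound; exists [set` s] => //.
  exact: seq_packingP.
apply: ge_ereal_sup => _ [pi /packing_seqP[s ps ->] <-].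
by rewrite packing_varE// lee_fin root_le_iff ?var_sum_ge0// h.
Qed.

Lemma small_var_le f eps c : bounded_on f (unit_cube R d) -> 0 <= c ->
  (small_var k p f eps <= c%:E)%E <->
  forall s, seq_packing s -> (forall Q, Q \in s -> Q.2 ^+ d <= eps) ->
    var_sum f s <= c `^ p.
Proof.
move=> fb c0; split=> [h s ps se|h].
  rewrite -root_le_iff// ?var_sum_ge0// -lee_fin -packing_varE//.
  apply: le_trans h; apply: ereal_sup_ubound; exists [set` s] => //.
  by split; [exact: seq_packingP|exact/mesh_le].
apply: ge_ereal_sup => _ [pi [/packing_seqP[s ps ->] /mesh_le se] <-].
by rewrite packing_varE// lee_fin root_le_iff ?var_sum_ge0// h.
Qed.

Lemma small_var_ge0 f eps : (0 <= small_var k p f eps)%E.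
Proof.
have ps : seq_packing ([::] : seq ('rV[R]_d * R)) by [].
apply: (@le_trans _ _ (packing_var k p f [set` [::]])).
  exact: poweR_ge0.
by apply: ereal_sup_ubound; exists [set` [::]] => //; split; [exact: seq_packingP|exact/mesh_le].
Qed.

Lemma powR_add_le (u v : R) : 0 <= u -> 0 <= v ->
  (u + v) `^ p <= 2 `^ p * (u `^ p + v `^ p).
Proof.
move=> u0 v0; have [uv|vu] := leP u v.
  apply: (@le_trans _ _ ((2 * v) `^ p)).
    by rewrite ge0_ler_powR ?nnegrE ?(ltW p0) ?addr_ge0 ?mulr_ge0//; lra.
  by rewrite powRM// ler_wpM2l ?powR_ge0// lerDr powR_ge0.
apply: (@le_trans _ _ ((2 * u) `^ p)).
  by rewrite ge0_ler_powR ?nnegrE ?(ltW p0) ?addr_ge0 ?mulr_ge0//; lra.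
by rewrite powRM// ler_wpM2l ?powR_ge0// lerDl powR_ge0.
Qed.

End Variation.

(** * The variation of smooth functions *)

Section SmoothVariation.
Variables (R : realType) (d k : nat) (p : R).
Hypotheses (hd : (0 < d)%N) (hp : 1 <= p) (hs : d%:R / p < k%:R).
Implicit Types (f g : 'rV[R]_d -> R) (s : seq ('rV[R]_d * R)).

Let p0 : 0 < p. Proof. exact: lt_le_trans hp. Qed.

Let kp : d%:R < k%:R * p. Proof. by rewrite -ltr_pdivrMr. Qed.

Lemma exprn_powR (r : R) : 0 <= r -> (r ^+ k) `^ p = r ^+ d * r `^ (k%:R * p - d%:R).
Proof.
move=> r0; have [->|rn0] := eqVneq r 0.
  rewrite [X in X * _]expr0n [d == 0%N]gtn_eqF// mul0r.
  case: k kp => [|k' _]; first by rewrite mul0r ltNge ler0n.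
  by rewrite expr0n/= powR0 ?gt_eqF.
rewrite -!powR_mulrn// -powRrM -powRD ?rn0 ?implybT//.
by congr (_ `^ _); ring.
Qed.

Lemma side_le1 s Q : seq_packing s -> Q \in s -> Q.2 <= 1.
Proof.
move=> ps Qs; have [_ cs _] := ps; have [Q0 _] := cs _ Qs.
have := box_sub (ltW Q0) (packing_box ps Qs) (Ordinal hd).
by rewrite !mxE; lra.
Qed.

(** A smooth function satisfies E_k = O(r^k) on cubes of side r, and
    r^(kp) = r^d r^(kp - d): the sum of the r^d is bounded by volume, and the
    exponent kp - d is positive because d/p < k. *)
Lemma smooth_var_sum g : smooth g -> exists2 K, 0 <= K &
  forall rho s, seq_packing s -> (forall Q, Q \in s -> Q.2 <= rho) ->
    var_sum k p g s <= K * rho `^ (k%:R * p - d%:R).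
Proof.
move=> sg.
have [C C0 HC] := smooth_poly_approx k 0 1 sg.
have [B _ gB] := continuous_bounded_box 0 1 (smooth_continuous sg).
exists (C `^ p * 4 ^+ d); first by rewrite mulr_ge0 ?powR_ge0.
move=> rho s ps srho; have [_ cs _] := ps.
apply: (@le_trans _ _ (C `^ p * (rho `^ (k%:R * p - d%:R) * \sum_(Q <- s) Q.2 ^+ d))); last first.
  rewrite -mulrA [in leRHS](mulrC (4 ^+ d)) ler_wpM2l ?powR_ge0// ler_wpM2l ?powR_ge0//.
  exact: volume_packing.
rewrite !mulr_sumr /var_sum big_seq [leRHS]big_seq; apply: ler_sum => Q Qs.
have [Q0 sub] := cs _ Qs; have Q0' := ltW Q0.
have [q kq hq] := HC Q.1 Q.2 Q0' (packing_box ps Qs).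
apply: (@le_trans _ _ ((C * Q.2 ^+ k) `^ p)).
  rewrite ge0_ler_powR ?nnegrE ?(ltW p0) ?err_ge0 ?mulr_ge0 ?exprn_ge0//.
    exact: cube_set_neq0.
  apply: (err_le (cube_set_neq0 Q0) _ kq) => [|x]; last by rewrite cube_setE//; exact: hq.
  by apply: bounded_on_cube ps Qs; exists B; rewrite unit_cubeE.
rewrite powRM ?exprn_ge0// exprn_powR// ler_wpM2l ?powR_ge0// mulrC.
rewrite ler_wpM2r ?exprn_ge0// ge0_ler_powR ?nnegrE ?subr_ge0 ?(ltW kp)//.
  exact: le_trans (srho _ Qs).
exact: srho.
Qed.

Lemma bounded_onP f A : [bounded f x | x in A] <-> bounded_on f A.
Proof.
split=> [[M [_ HM]]|[B HB]].
  by exists (M + 1) => x Ax; apply: (HM (M + 1)) => //; rewrite ltrDl.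
exists B; split; first exact: num_real.
by move=> M BM x Ax; rewrite /= (le_trans (HB _ Ax))// ltW.
Qed.

Lemma smooth_V_space g : smooth g -> V_space k p g.
Proof.
move=> sg; have [B _ gB] := continuous_bounded_box 0 1 (smooth_continuous sg).
have gb : bounded_on g (unit_cube R d) by exists B; rewrite unit_cubeE.
split; first exact/bounded_onP.
have [K K0 HK] := smooth_var_sum sg.
apply: le_lt_trans (ltry (K `^ p^-1)).
apply/(V_seminorm_le k hp gb (powR_ge0 _ _)) => s ps.
rewrite -powRrM mulVf ?gt_eqF// powRr1//.
have := HK 1 s ps (fun Q Qs => side_le1 ps Qs).
by rewrite powR1 mulr1.
Qed.

Lemma small_var_cvg0 f :
  (small_var k p f eps @[eps --> 0^'+] --> 0%E) <->
  (forall e : R, 0 < e -> exists2 eps : R, 0 < eps & (small_var k p f eps <= e%:E)%E).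
Proof.
split=> [/fine_cvgP[fin /cvgr0Pnorm_le h] e e0|h].
  have H : \forall eps \near 0^'+, 0 < eps /\ (small_var k p f eps <= e%:E)%E.
    near=> eps; split; first by near: eps; exact: nbhs_right_gt.
    have fe : small_var k p f eps \is a fin_num by near: eps.
    rewrite -(fineK fe) lee_fin (le_trans (ler_norm _))//.
    by near: eps; exact: h.
  by have [eps [eps0 Heps]] := filter_ex H; exists eps.
have H e : 0 < e -> \forall eps \near 0^'+, (small_var k p f eps <= e%:E)%E.
  move=> /h[eps eps0 heps]; near=> eps'.
  apply: le_trans heps; apply: le_ereal_sup => x [pi [ppi mpi] <-].
  exists pi => //; split=> //; apply: le_trans mpi _; rewrite lee_fin.
  by near: eps'; exact: nbhs_right_le.
apply/fine_cvgP; split.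
  near=> eps; rewrite fin_real// (lt_le_trans _ (small_var_ge0 _ _ _ _))//=.
  apply: (@le_lt_trans _ _ (1%:E)); last exact: ltry.
  by near: eps; exact: H.
apply/cvgr0Pnorm_le => e e0; near=> eps => /=.
have he : (small_var k p f eps <= e%:E)%E by near: eps; exact: H.
have fe : small_var k p f eps \is a fin_num.
  by rewrite fin_real// (lt_le_trans _ (small_var_ge0 _ _ _ _))//= (le_lt_trans he)// ltry.
rewrite ger0_norm ?fine_ge0 ?small_var_ge0//.
by rewrite -lee_fin fineK.
Unshelve. all: by end_near. Qed.

(** Direct implication: the variation of f over small cubes is at most that of
    f - g plus that of the smooth function g. *)
Lemma v_space_small_var f : v_space k p f ->
  forall e : R, 0 < e -> exists2 eps : R, 0 < eps & (small_var k p f eps <= e%:E)%E.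
Proof.
move=> [[/bounded_onP fb _] Hv] e e0.
(* This choice makes 2^p (c^p + c^p) = e^p, which absorbs [powR_add_le]. *)
pose c := e / 2 / 2 `^ p^-1.
have c0 : 0 < c by rewrite !divr_gt0// powR_gt0.
have [g [[g' sg' gg'] _] Vfg] := Hv _ c0.
have [B _ gB] := continuous_bounded_box 0 1 (smooth_continuous sg').
have gb : bounded_on g' (unit_cube R d) by exists B; rewrite unit_cubeE.
have gb' : bounded_on g (unit_cube R d).
  by case: gb => B' HB'; exists B' => x ux; rewrite gg'// HB'.
have [K K0 HK] := smooth_var_sum sg'.
set t := k%:R * p - d%:R in HK; have t0 : 0 < t by rewrite subr_gt0.
pose rho := (c `^ p / (K + 1)) `^ t^-1.
have cp0 : 0 < c `^ p by rewrite powR_gt0.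
have K1 : 0 < K + 1 by rewrite ltr_wpDl.
have rho0 : 0 < rho by rewrite powR_gt0// divr_gt0.
exists (rho ^+ d); first by rewrite exprn_gt0.
apply/(small_var_le k hp _ fb (ltW e0)) => s ps srho.
have [_ cs _] := ps.
have srho' Q : Q \in s -> Q.2 <= rho.
  move=> Qs; have [Q0 _] := cs _ Qs; have := srho _ Qs.
  by rewrite ler_pXn2r// nnegrE ltW.
have S1 : var_sum k p (fun x => f x - g x) s <= c `^ p.
  have fgb := bounded_onB fb gb'.
  by move: s ps {srho cs srho'}; apply/(V_seminorm_le k hp fgb (ltW c0))/ltW.
have S2 : var_sum k p g' s <= c `^ p.
  apply: le_trans (HK rho s ps srho') _.
  rewrite /rho -powRrM mulVf ?gt_eqF// powRr1 ?divr_ge0 ?powR_ge0 ?(ltW K1)//.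
  by rewrite mulrCA ler_piMr ?powR_ge0// ler_pdivrMr// mul1r lerDl.
have -> : e `^ p = 2 `^ p * (c `^ p + c `^ p).
  have eE : e = 2 * (c * 2 `^ p^-1).
    by rewrite /c divfK ?gt_eqF ?powR_gt0// mulrCA divff ?mulr1.
  have cE : (c * 2 `^ p^-1) `^ p = c `^ p + c `^ p.
    rewrite powRM ?powR_ge0 ?(ltW c0)// -powRrM mulVf ?gt_eqF// powRr1//.
    by rewrite mulrDr mulr1.
  rewrite -cE [in LHS]eE; apply: powRM => //.
  by rewrite mulr_ge0 ?powR_ge0// ltW.
apply: le_trans (ler_wpM2l (powR_ge0 _ _) (lerD S1 S2)).
rewrite /var_sum -big_split/= mulr_sumr big_seq [leRHS]big_seq.
apply: ler_sum => Q Qs; have [Q0 sub] := cs _ Qs.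
have An0 := cube_set_neq0 Q0.
have fA := bounded_on_cube fb ps Qs; have gA := bounded_on_cube gb' ps Qs.
have -> : err k g' (cube_set Q) = err k g (cube_set Q).
  rewrite /err /best_approx; congr (fine (ereal_inf _)); apply: eq_imagel => m _.
  by congr ereal_sup; apply: eq_imagel => x Qx; rewrite gg'//; exact: sub.
apply: le_trans (powR_add_le hp _ _); rewrite ?err_ge0//.
rewrite ge0_ler_powR ?nnegrE ?(ltW p0) ?addr_ge0 ?err_ge0//.
exact: err_triangle.
Qed.

End SmoothVariation.

(** * A smooth local quasi-interpolant *)

Section KernelsOnTheLine.
Variables (R : realType) (k : nat).
Hypothesis hk : (0 < k)%N.

Definition interp_pt (i : nat) : R := i%:R / k%:R.

Lemma interp_pt_inj : injective interp_pt.
Proof.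
move=> i j /(congr1 ( *%R^~ k%:R)); rewrite !divfK ?pnatr_eq0 -?lt0n//.
by move/eqP; rewrite eqr_nat => /eqP.
Qed.

Lemma interp_pt_itv (a : 'I_k) : 0 <= interp_pt a <= 1.
Proof.
by rewrite divr_ge0//= ler_pdivrMr ?ltr0n// mul1r ler_nat ltnW.
Qed.

Definition lagrange_basis (a : 'I_k) : {poly R} := tnth (k.-lagrange interp_pt) a.

(** The two shapes of the kernels, up to integer translation. The second one, for
    b = true, serves the last grid point only: there the interpolation nodes are
    shifted one cell to the left, into the unit interval. *)
Definition kernel_shape (b : bool) (a : 'I_k) (u : R) : R :=
  bump u * (lagrange_basis a).[u + b%:R].

Lemma smooth1_kernel_shape b a : smooth1 (kernel_shape b a).
Proof.
apply: smooth1M; first exact: smooth1_bump.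
rewrite (_ : (fun u => _) = fun u => (lagrange_basis a).[1 * u + b%:R]).
  exact/smooth1_affine/smooth1_horner.
by apply/funext => u; rewrite mul1r.
Qed.

Variable n : nat.
Notation N := n.+1.

Definition node1 (j : 'I_N.+1) (a : 'I_k) : R :=
  ((minn j n)%:R + interp_pt a) / N%:R.

Definition kernel1 (j : 'I_N.+1) (a : 'I_k) (t : R) : R :=
  kernel_shape (j == ord_max) a (N%:R * t - j%:R).

Lemma smooth1_kernel1 j a : smooth1 (kernel1 j a).
Proof. exact/(smooth1_affine N%:R (- j%:R))/smooth1_kernel_shape. Qed.

Lemma kernel1_eq0 (j : 'I_N.+1) (a : 'I_k) (t : R) : 1 < `|N%:R * t - j%:R| -> kernel1 j a t = 0.
Proof. by move=> h; rewrite /kernel1 /kernel_shape bump_eq0 ?mul0r. Qed.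

Lemma node1_near (j : 'I_N.+1) a :
  j%:R - 1 <= N%:R * node1 j a <= j%:R + 1 /\ 0 <= N%:R * node1 j a <= N%:R.
Proof.
have /andP[a0 a1] := interp_pt_itv a.
rewrite /node1 mulrCA divff ?pnatr_eq0// mulr1.
have jn : (j <= n.+1)%N by rewrite -ltnS.
have [jln|nj] := leqP j n.
  have : j%:R <= n%:R :> R by rewrite ler_nat.
  have : 0 <= j%:R :> R by [].
  by rewrite -natr1; lra.
have -> : (j : nat) = n.+1 by apply/eqP; rewrite eqn_leq jn.
have : 0 <= n%:R :> R by [].
by rewrite -natr1; lra.
Qed.

(** Each bump multiplies the Lagrange interpolant on its own nodes, which equals
    the monomial; then the bumps add up to 1. *)
Lemma kernel1_reproduces (e : nat) (t : R) : (e < k)%N -> 0 <= t <= 1 ->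
  \sum_(j < N.+1) \sum_(a < k) node1 j a ^+ e * kernel1 j a t = t ^+ e.
Proof.
move=> ek /andP[t0 t1].
rewrite -[RHS]mul1r -(@sum_bump R N (N%:R * t)); last first.
  by rewrite mulr_ge0//= ler_piMr.
rewrite mulr_suml; apply: eq_bigr => j _.
pose c : R := (minn j n)%:R.
pose pe : {poly R} := ((N%:R^-1)%:P * ('X + c%:P)) ^+ e.
have spe : (size pe <= k)%N.
  apply: leq_trans (size_poly_exp_leq _ _) _; apply: leq_ltn_trans ek.
  rewrite size_Cmul ?invr_eq0 ?pnatr_eq0// size_XaddC mul1n//.
have peE u : pe.[u] = ((u + c) / N%:R) ^+ e.
  by rewrite /pe !hornerE mulrC.
have jE : N%:R * t - j%:R + (j == ord_max)%:R = N%:R * t - c.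
  rewrite /c; have jn : (j <= n.+1)%N by rewrite -ltnS.
  rewrite -val_eqE /=; have [jln|nj] := leqP j n.
    by rewrite ltn_eqF// addr0.
  have -> : (j : nat) = n.+1 by apply/eqP; rewrite eqn_leq jn.
  by rewrite eqxx /= mulr1n -natr1; ring.
have := congr1 (fun q : {poly R} => q.[N%:R * t - c])
  (lagrange_gen hk interp_pt_inj spe).
rewrite peE subrK [_ * t]mulrC mulfK ?pnatr_eq0// => ->.
rewrite horner_sum mulr_sumr; apply: eq_bigr => a _.
rewrite /kernel1 /kernel_shape jE hornerM hornerC peE /node1 -/c [_ * t]mulrC.
by rewrite [interp_pt a + c]addrC mulrCA.
Qed.

End KernelsOnTheLine.

Section QuasiInterpolant.
Variables (R : realType) (d k : nat).
Hypothesis hk : (0 < k)%N.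

Definition shape (sh : {ffun 'I_d -> bool * 'I_k}) : 'rV[R]_d -> R :=
  tensor (fun i => kernel_shape (sh i).1 (sh i).2).

(** Up to the affine changes of variables x |-> N x - j, all kernels have finitely
    many shapes, so one constant serves all of them and all N. *)
Lemma shape_bounds : exists2 C, 0 <= C & forall sh,
  (forall u, box (const_mx (-3)) 6 u -> `|shape sh u| <= C) /\
  (forall a (r : R), 0 <= r -> box a r `<=` box (const_mx (-3)) 6 ->
    exists2 q, is_poly k q & forall u, box a r u -> `|shape sh u - q u| <= C * r ^+ k).
Proof.
have ss sh : smooth (shape sh) by apply: smooth_tensor => i; exact: smooth1_kernel_shape.
have /choice[C HC] sh : exists C, [/\ 0 <= C,
    forall u, box (const_mx (-3)) 6 u -> `|shape sh u| <= C &
    forall a (r : R), 0 <= r -> box a r `<=` box (const_mx (-3)) 6 ->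
      exists2 q, is_poly k q & forall u, box a r u -> `|shape sh u - q u| <= C * r ^+ k].
  have [C1 C10 H1] := continuous_bounded_box (const_mx (-3)) 6 (smooth_continuous (ss sh)).
  have [C2 C20 H2] := smooth_poly_approx k (const_mx (-3)) 6 (ss sh).
  exists (C1 + C2); split; first exact: addr_ge0.
    by move=> u bu; rewrite (le_trans (H1 _ bu))// lerDl.
  move=> a r r0 sub; have [q kq hq] := H2 a r r0 sub; exists q => // u bu.
  by rewrite (le_trans (hq _ bu))// ler_wpM2r ?exprn_ge0// lerDr.
have C0 sh : 0 <= C sh by have [] := HC sh.
have Cle sh : C sh <= \sum_sh C sh.
  by rewrite (bigD1 sh)//= lerDl sumr_ge0.
exists (\sum_sh C sh); first exact: sumr_ge0.
move=> sh; have [_ H1 H2] := HC sh; split.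
  by move=> u bu; rewrite (le_trans (H1 _ bu)).
move=> a r r0 sub; have [q kq hq] := H2 a r r0 sub; exists q => // u bu.
by rewrite (le_trans (hq _ bu))// ler_wpM2r ?exprn_ge0.
Qed.

Variable n : nat.
Notation N := n.+1.
Notation idx := {ffun 'I_d -> 'I_N.+1 * 'I_k}.

Definition node (c : idx) : 'rV[R]_d := \row_i node1 R (c i).1 (c i).2.

Definition kernel (c : idx) : 'rV[R]_d -> R :=
  tensor (fun i => kernel1 (c i).1 (c i).2).

Definition quasi_interp (f : 'rV[R]_d -> R) (x : 'rV[R]_d) : R :=
  \sum_c f (node c) * kernel c x.

Lemma smooth_quasi_interp f : smooth (quasi_interp f).
Proof.
apply: (@smooth_tensor_sum _ _ _ _ (fun c => f (node c))
  (fun (c : idx) i => kernel1 (c i).1 (c i).2)) => c i.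
exact: smooth1_kernel1.
Qed.

Lemma kernel_shapeE c x : kernel c x =
  shape [ffun i => ((c i).1 == ord_max, (c i).2)]
    (N%:R *: x - \row_i ((c i).1 : nat)%:R).
Proof.
by apply: eq_bigr => i _; rewrite ffunE !mxE.
Qed.

(** Both the kernels and the monomials are products over the coordinates, so the
    reproduction of polynomials reduces to one variable. *)
Lemma quasi_interp_poly q x : is_poly k q -> box 0 1 x ->
  quasi_interp q x = q x.
Proof.
move=> /is_poly_monomials[s [a [sk qE]]] bx.
rewrite /quasi_interp qE; under eq_bigr do rewrite qE mulr_suml.
rewrite exchange_big/= big_seq [RHS]big_seq; apply: eq_bigr => m ms.
under eq_bigr do rewrite -mulrA; rewrite -mulr_sumr; congr (_ * _).
transitivity (\prod_(i < d) \sum_(ja : 'I_N.+1 * 'I_k)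
    node1 R ja.1 ja.2 ^+ m i * kernel1 ja.1 ja.2 (x ord0 i)).
  rewrite bigA_distr_bigA; apply: eq_bigr => c _.
  by rewrite /kernel /tensor -big_split; apply: eq_bigr => i _; rewrite mxE.
apply: eq_bigr => i _; rewrite -(pair_bigA _ (fun j a =>
  node1 R j a ^+ m i * kernel1 j a (x ord0 i)))/=.
apply: kernel1_reproduces => //.
  by apply: leq_ltn_trans (sk _ ms); rewrite (bigD1 i)//= leq_addr.
by have := bx i; rewrite mxE add0r.
Qed.

(** The cell with corner z / N is z / N + [0, 1/N]^d; the doubled cell contains
    the cubes of side at most 1/N with corner in the cell. *)
Definition double_cell (z : {ffun 'I_d -> 'I_N}) : set 'rV[R]_d :=
  [set x | box 0 1 x /\ forall i, (z i)%:R <= N%:R * x ord0 i <= (z i)%:R + 2].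

Definition active (z : {ffun 'I_d -> 'I_N}) : {pred idx} :=
  [pred c : idx | [forall i, (z i <= (c i).1.+1 <= z i + 4)%N]].

Lemma active_near z (c : idx) : c \in active z -> forall i,
  (z i)%:R - 1 <= ((c i).1)%:R :> R /\ ((c i).1)%:R <= (z i)%:R + 3 :> R.
Proof.
move=> /forallP h i; have /andP[] := h i.
rewrite -(ler_nat R) -(ler_nat R (c i).1.+1) -natr1 natrD => h1 h2.
by split; lra.
Qed.

Lemma kernel_inactive z c x : double_cell z x -> c \notin active z -> kernel c x = 0.
Proof.
move=> [bx zx]; rewrite inE negb_forall => /existsP[i zi].
rewrite /kernel /tensor (bigD1 i)//= kernel1_eq0 ?mul0r//.
have /andP[zx1 zx2] := zx i.
move: zi; rewrite negb_and -!ltnNge lter_normr => /orP[h|h]; apply/orP.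
  by move: h; rewrite -(ltr_nat R) -natr1 => h; left; lra.
have : (z i)%:R + 4 <= ((c i).1)%:R :> R by rewrite -natrD ler_nat.
by right; lra.
Qed.

Lemma card_active z : (#|active z| <= (5 * k) ^ d)%N.
Proof.
pose h (c : idx) : {ffun 'I_d -> 'I_5 * 'I_k} :=
  [ffun i => (inord ((c i).1.+1 - z i), (c i).2)].
apply: leq_trans (@leq_card_in _ _ h (active z) _) _; last first.
  by rewrite card_ffun card_prod !card_ord.
move=> c c' /forallP ac /forallP ac' /ffunP hc; apply/ffunP => i.
have := hc i; rewrite !ffunE => -[/(congr1 val) /= e1 e2].
have /andP[a1 a2] := ac i; have /andP[b1 b2] := ac' i.
have : (c i).1 = (c' i).1.
  apply: val_inj => /=; move: e1; rewrite !inordK ?ltnS ?leq_subLR// => e1.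
  by apply: succn_inj; rewrite -(subnK a1) -(subnK b1) e1.
by move: e2; case: (c i) (c' i) => [u v] [u' v'] /= -> ->.
Qed.

(** The star contains the doubled cell and all the nodes of the kernels that do not
    vanish there. It has the centre of the doubled cell, except near the boundary,
    where it is pushed back into the unit cube. *)
Definition star (z : {ffun 'I_d -> 'I_N}) : 'rV[R]_d * R :=
  (\row_i ((minn (z i - 2) (N - 6))%:R / N%:R), 6 / N%:R).

Hypothesis hn : (5 <= n)%N.

Let N0 : 0 < N%:R :> R. Proof. by []. Qed.

Lemma star_gt0 z : 0 < (star z).2.
Proof. by rewrite divr_gt0. Qed.

(** Near the boundary the lower or upper bound of the star comes from the unit cube,
    away from it from the distance to the cell. *)
Lemma starP (z : {ffun 'I_d -> 'I_N}) (x : 'rV[R]_d) : (forall i, 0 <= N%:R * x ord0 i <= N%:R /\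
    (z i)%:R - 2 <= N%:R * x ord0 i <= (z i)%:R + 4) -> box (star z).1 (star z).2 x.
Proof.
move=> h i; rewrite mxE.
have [/andP[x0 x1] /andP[z0 z1]] := h i.
rewrite -mulrDl ler_pdivrMr// ler_pdivlMr// [x ord0 i * _]mulrC.
have zn : (z i <= n)%N by rewrite -ltnS.
have n6 : (N - 6)%:R = N%:R - 6 :> R by rewrite natrB.
have [z2|z2] := leqP 2 (z i).
  have zi2 : (z i - 2)%:R = (z i)%:R - 2 :> R by rewrite natrB.
  have [le|lt] := leqP (z i - 2) (N - 6); first by rewrite zi2; lra.
  have : (N - 6)%:R <= (z i - 2)%:R :> R by rewrite ler_nat ltnW.
  by rewrite n6 zi2; lra.
have -> : (z i - 2 = 0)%N by apply/eqP; rewrite subn_eq0 ltnW.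
have : (z i)%:R <= 1 :> R by rewrite (ler_nat _ _ 1).
by rewrite min0n; lra.
Qed.

Lemma star_unit z : box (star z).1 (star z).2 `<=` box 0 1.
Proof.
move=> x bx i; have := bx i; rewrite !mxE add0r -mulrDl => /andP[x0 x1].
rewrite (le_trans _ x0) ?divr_ge0//= (le_trans x1)// ler_pdivrMr// mul1r.
rewrite -natrD ler_nat; apply: leq_trans (leq_add (geq_minr _ _) (leqnn 6)) _.
by rewrite subnK.
Qed.

Lemma double_cell_star z : double_cell z `<=` box (star z).1 (star z).2.
Proof.
move=> x [bx zx]; apply: starP => i; have := bx i; have := zx i.
rewrite mxE add0r => /andP[z0 z1] /andP[x0 x1]; split.
  by rewrite mulr_ge0//= ler_piMr.
by lra.
Qed.

Lemma node_star z c : c \in active z -> box (star z).1 (star z).2 (node c).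
Proof.
move=> /active_near cz; apply: starP => i; rewrite mxE.
have [+ ->] := @node1_near R k hk n (c i).1 (c i).2.
by have := cz i; split=> //; lra.
Qed.

Lemma rescaled_double_cell z c x : c \in active z -> double_cell z x ->
  box (const_mx (-3)) 6 (N%:R *: x - \row_i ((c i).1 : nat)%:R : 'rV[R]_d).
Proof.
move=> /active_near cz [_ zx] i; have := cz i; have := zx i.
by rewrite !mxE; lra.
Qed.

Lemma quasi_interp_split f q z x : is_poly k q -> double_cell z x ->
  quasi_interp f x = q x + \sum_(c in active z) (f (node c) - q (node c)) * kernel c x.
Proof.
move=> kq zx; have [bx _] := zx; rewrite -(quasi_interp_poly kq bx).
rewrite [X in _ + X](_ : _ = \sum_c (f (node c) - q (node c)) * kernel c x).
  by rewrite -big_split /=; apply: eq_bigr => c _; rewrite -mulrDl addrC subrK.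
rewrite [RHS](bigID (mem (active z)))/= [X in _ + X]big1 ?addr0// => c cz.
by rewrite (kernel_inactive zx) ?mulr0.
Qed.

Variable C : R.
Hypothesis C0 : 0 <= C.
Hypothesis HC : forall sh,
  (forall u, box (const_mx (-3)) 6 u -> `|shape sh u| <= C) /\
  (forall a (r : R), 0 <= r -> box a r `<=` box (const_mx (-3)) 6 ->
    exists2 q, is_poly k q & forall u, box a r u -> `|shape sh u - q u| <= C * r ^+ k).

Definition local_const : R := 1 + ((5 * k) ^ d)%:R * C.

Lemma sum_active_le z (F : idx -> R) (B : R) : 0 <= B ->
  (forall c, c \in active z -> `|F c| <= B) ->
  `|\sum_(c in active z) F c| <= ((5 * k) ^ d)%:R * B.
Proof.
move=> B0 h; apply: le_trans (ler_norm_sum _ _ _) _.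
apply: (@le_trans _ _ (\sum_(c in active z) B)); first exact: ler_sum.
by rewrite sumr_const -[leLHS]mulr_natl ler_wpM2r// ler_nat card_active.
Qed.

(** The error f - G is the error f - q minus its own quasi-interpolant, in which a
    bounded number of bounded kernels intervene. *)
Lemma quasi_interp_near f q z x (c : R) : is_poly k q -> 0 <= c ->
  (forall y, box (star z).1 (star z).2 y -> `|f y - q y| <= c) ->
  double_cell z x -> `|f x - quasi_interp f x| <= local_const * c.
Proof.
move=> kq c0 fq zx; rewrite (quasi_interp_split f kq zx) opprD addrA.
apply: le_trans (ler_normB _ _) _; rewrite mulrDl mul1r lerD ?fq//.
  exact: double_cell_star.
rewrite -mulrA; apply: sum_active_le => [|e ez]; first exact: mulr_ge0.
rewrite normrM mulrC ler_pM//; last exact/fq/node_star.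
rewrite kernel_shapeE; have [h _] := HC [ffun i => ((e i).1 == ord_max, (e i).2)].
by apply: h; exact: rescaled_double_cell ez zx.
Qed.

(** Since the operator reproduces q, its smoothness on the scale 1/N is measured by
    the distance of f to q: only the kernels, multiplied by the small values of
    f - q, have to be approximated by polynomials. *)
Lemma quasi_interp_approx f q z a (r c : R) : is_poly k q -> 0 <= c -> 0 <= r ->
  (forall y, box (star z).1 (star z).2 y -> `|f y - q y| <= c) ->
  box a r `<=` double_cell z ->
  exists2 q', is_poly k q' & forall x, box a r x ->
    `|quasi_interp f x - q' x| <= local_const * c * (N%:R * r) ^+ k.
Proof.
move=> kq c0 r0 fq sub.
have Nr0 : 0 <= N%:R * r by rewrite mulr_ge0.
pose jv (e : idx) : 'rV[R]_d := \row_i ((e i).1 : nat)%:R.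
have /choice[q' Hq'] (e : idx) : exists q', is_poly k q' /\
    (e \in active z -> forall x, box a r x -> `|kernel e x - q' x| <= C * (N%:R * r) ^+ k).
  have [ez|_] := boolP (e \in active z); last first.
    by exists (fun=> 0); split=> //; exact: is_poly0.
  have [_ H] := HC [ffun i => ((e i).1 == ord_max, (e i).2)].
  have [|q' kq' hq'] := H (N%:R *: a - jv e) (N%:R * r) Nr0.
    move=> u bu; pose x := N%:R^-1 *: (u + jv e).
    have ux : u = N%:R *: x - jv e.
      by rewrite scalerA divff ?pnatr_eq0// scale1r addrK.
    rewrite ux; apply: (rescaled_double_cell ez); apply: sub => i.
    have xE : N%:R * x ord0 i = u ord0 i + ((e i).1 : nat)%:R.
      by rewrite !mxE mulrA divff ?pnatr_eq0// mul1r.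
    have bui := bu i; rewrite !mxE in bui; have /andP[u0 u1] := bui.
    by apply/andP; split; rewrite -(ler_pM2l N0) xE ?mulrDr; lra.
  exists (fun x => q' (N%:R *: x - jv e)); split; first exact: is_poly_affine.
  move=> _ x bx; rewrite kernel_shapeE; apply: hq' => i.
  have := bx i; rewrite !mxE => /andP[x0 x1].
  have := ler_wpM2l (ltW N0) x0; have := ler_wpM2l (ltW N0) x1.
  by rewrite mulrDr; lra.
exists (fun x => q x + \sum_(e in active z) (f (node e) - q (node e)) * q' e x).
  apply: is_polyD => //; apply: is_poly_sum => e; apply: is_polyZ.
  by have [] := Hq' e.
move=> x bx; rewrite (quasi_interp_split f kq (sub _ bx)).
rewrite opprD addrACA subrr add0r -sumrB.
under eq_bigr do rewrite -mulrBr.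
have B0 : 0 <= C * (N%:R * r) ^+ k by rewrite mulr_ge0 ?exprn_ge0.
apply: (@le_trans _ _ (((5 * k) ^ d)%:R * (c * (C * (N%:R * r) ^+ k)))).
  apply: sum_active_le => [|e ez]; first exact: mulr_ge0.
  rewrite normrM ler_pM//; first exact/fq/node_star.
  by have [_] := Hq' e; exact.
rewrite /local_const [c * _]mulrCA !mulrA -[leLHS]mulrA -[leRHS]mulrA.
by rewrite ler_wpM2r ?mulr_ge0 ?exprn_ge0// lerDr.
Qed.

End QuasiInterpolant.

(** * Variation of the approximation error *)

(** Clamping the corner to the unit cube moves it by at most three cells to the left
    and two to the right, so indices at least 12 apart keep stars at least 6 apart. *)
Lemma clamp_far (a b m : nat) : (a < b -> a %% 12 = b %% 12 -> b <= m -> 5 <= m ->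
  minn (a - 2) (m.+1 - 6) + 6 <= minn (b - 2) (m.+1 - 6))%N.
Proof.
move=> ab e bm m5; have : (a + 12 <= b)%N by lia.
by rewrite /minn; do 2 case: ltnP => ?; lia.
Qed.

Section Counting.
Variables (R : realType) (d k n : nat) (p : R).
Hypotheses (hd : (0 < d)%N) (hk : (0 < k)%N) (hp : 1 <= p) (hs : d%:R / p < k%:R).
Hypothesis hn : (5 <= n)%N.
Notation N := n.+1.
Notation cell := {ffun 'I_d -> 'I_N}.
Implicit Types (f : 'rV[R]_d -> R) (x : 'rV[R]_d) (z : cell)
  (Q : 'rV[R]_d * R) (s : seq ('rV[R]_d * R)).

Let p0 : 0 < p. Proof. exact: lt_le_trans hp. Qed.

Let N0 : 0 < N%:R :> R. Proof. by []. Qed.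

Let NV0 : 0 < N%:R^-1 :> R. Proof. by rewrite invr_gt0. Qed.

Let NV : N%:R * N%:R^-1 = 1 :> R. Proof. by rewrite divff ?pnatr_eq0. Qed.

Definition cell_of x : cell := [ffun i => inord (minn (Num.truncn (N%:R * x ord0 i)) n)].

Lemma cell_ofP x i : box 0 1 x ->
  (cell_of x i)%:R <= N%:R * x ord0 i /\ N%:R * x ord0 i <= (cell_of x i)%:R + 1.
Proof.
move=> bx; have := bx i; rewrite mxE add0r => /andP[x0 x1].
have xN0 : 0 <= N%:R * x ord0 i by rewrite mulr_ge0.
have xN : N%:R * x ord0 i <= N%:R by rewrite ler_piMr.
rewrite ffunE inordK ?ltnS ?geq_minr//.
have /andP[t1 t2] := truncn_itv xN0.
have [tn|nt] := leqP (Num.truncn (N%:R * x ord0 i)) n.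
  by split=> //; rewrite natr1 ltW.
split; last by rewrite natr1.
by apply: le_trans t1; rewrite ler_nat ltnW.
Qed.

Definition star_err f z : R := err k f (cube_set (star R z)).

Lemma star_neq0 z : cube_set (star R z) !=set0.
Proof. exact/cube_set_neq0/star_gt0. Qed.

Lemma star_err_ge0 f z : 0 <= star_err f z.
Proof. exact/err_ge0/star_neq0. Qed.

Lemma bounded_on_sub f A : bounded_on f (box 0 1) -> A `<=` box 0 1 -> bounded_on f A.
Proof. by move=> [B HB] sub; exists B => x /sub; exact: HB. Qed.

Lemma star_approx f z (e : R) : bounded_on f (box 0 1) -> 0 < e -> exists2 q,
  is_poly k q & forall y, box (star R z).1 (star R z).2 y -> `|f y - q y| <= star_err f z + e.
Proof.
move=> fb e0; rewrite -(cube_setE (star_gt0 R z)).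
apply: err_lt; [exact: star_neq0| |by rewrite ltrDl].
by apply: bounded_on_sub fb _; rewrite (cube_setE (star_gt0 R z)); exact: star_unit.
Qed.

(** Best approximants are only used up to an arbitrary e, so that their existence is
    never at stake. *)
Lemma le_limit (u v K : R) : 0 <= K -> (forall e, 0 < e -> u <= v + K * e) -> u <= v.
Proof.
move=> K0 h; apply/ler_addgt0Pr => e e0.
have K1 : 0 < K + 1 by rewrite ltr_wpDl.
apply: le_trans (h (e / (K + 1)) _) _; first by rewrite divr_gt0.
by rewrite lerD2l mulrCA ler_piMr ?(ltW e0)// ler_pdivrMr// mul1r lerDl.
Qed.

Variable C : R.
Hypothesis C0 : 0 <= C.
Hypothesis HC : forall sh : {ffun 'I_d -> bool * 'I_k},
  (forall u, box (const_mx (-3)) 6 u -> `|shape sh u| <= C) /\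
  (forall a (r : R), 0 <= r -> box a r `<=` box (const_mx (-3)) 6 ->
    exists2 q, is_poly k q & forall u, box a r u -> `|shape sh u - q u| <= C * r ^+ k).
Notation L := (local_const d k C).

Lemma local_const_ge0 : 0 <= L.
Proof. by rewrite addr_ge0// mulr_ge0. Qed.

Definition capped Q : R := Num.min Q.2 N%:R^-1.

(** On a cube smaller than the cells, f and the quasi-interpolant are handled
    separately, and the latter is smooth; on a larger cube the two functions are
    uniformly close, and the point x is taken in the worst cell met by the cube. *)
Lemma err_quasi_interp f Q : bounded_on f (box 0 1) -> 0 < Q.2 ->
  box Q.1 Q.2 `<=` box 0 1 -> exists2 x, box Q.1 Q.2 x &
  err k (fun y => f y - quasi_interp k n f y) (cube_set Q) <=
    (if Q.2 <= N%:R^-1 then err k f (cube_set Q) else 0) +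
    L * star_err f (cell_of x) * (N%:R * capped Q) ^+ k.
Proof.
move=> fb Q0 sub; set G := quasi_interp k n f.
have Gb : bounded_on G (box 0 1).
  have [B _ GB] := continuous_bounded_box 0 1 (smooth_continuous (smooth_quasi_interp k n f)).
  by exists B.
have An0 := cube_set_neq0 Q0.
have subA : cube_set Q `<=` box 0 1 by rewrite cube_setE.
have fA := bounded_on_sub fb subA; have GA := bounded_on_sub Gb subA.
have L0 := local_const_ge0.
have Q1 : box Q.1 Q.2 Q.1 by move=> i; rewrite lexx lerDl ltW.
rewrite /capped; case: ifPn => small; last first.
  rewrite -ltNge in small; rewrite min_r ?(ltW small)// NV expr1n.
  pose met z := `[< exists2 x, box Q.1 Q.2 x & cell_of x = z >].
  have m0 : met (cell_of Q.1) by apply/asboolP; exists Q.1.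
  case: (@arg_maxP _ _ _ (cell_of Q.1) met (star_err f) m0) => z /asboolP[x xQ xz] zmax.
  exists x => //; rewrite xz mulr1 add0r; apply: (le_limit L0) => e e0; rewrite -mulrDr.
  apply: (err_le An0 (bounded_onB fA GA) (is_poly0 R d k)) => y; rewrite cube_setE// => yQ.
  rewrite subr0; have [q kq hq] := star_approx (cell_of y) fb e0.
  apply: (@le_trans _ _ (L * (star_err f (cell_of y) + e))).
    apply: (quasi_interp_near hk hn C0 HC kq _ hq).
      by rewrite addr_ge0 ?star_err_ge0 ?ltW.
    split=> [|i]; first exact: sub.
    by have := cell_ofP i (sub _ yQ); lra.
  rewrite ler_wpM2l// lerD2r; apply: zmax.
  by apply/asboolP; exists y.
exists Q.1 => //; rewrite min_l//.
apply: le_trans (err_diff_le k An0 fA GA) _; rewrite lerD2l.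
have t0 : 0 <= (N%:R * Q.2) ^+ k by rewrite exprn_ge0// mulr_ge0 ?(ltW Q0).
apply: (@le_limit _ _ (L * (N%:R * Q.2) ^+ k)) => [|e e0]; first exact: mulr_ge0.
have [q kq hq] := star_approx (cell_of Q.1) fb e0.
have se0 : 0 <= star_err f (cell_of Q.1) + e by rewrite addr_ge0 ?star_err_ge0 ?ltW.
have [|q' kq' hq'] := @quasi_interp_approx R d k hk n hn C C0 HC f q (cell_of Q.1) Q.1 Q.2
   (star_err f (cell_of Q.1) + e) kq se0 (ltW Q0) hq.
  move=> y yQ; split=> [|i]; first exact: sub.
  have := cell_ofP i (sub _ Q1).
  have /andP[y1 y2] := yQ i.
  have := ler_wpM2l (ltW N0) y1; have := ler_wpM2l (ltW N0) y2.
  have := ler_wpM2l (ltW N0) small; rewrite mulrDr NV; lra.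
apply: (err_le An0 GA kq') => y; rewrite cube_setE// => /hq' h.
by apply: le_trans h _; rewrite mulrDr mulrDl [L * _ * e]mulrAC.
Qed.

Definition cell_class z : {ffun 'I_d -> 'I_12} := [ffun i => inord (z i %% 12)].

(** The period 12 leaves room for the side 6 of the stars and for their shift by
    up to three cells near the boundary of the unit cube. *)
Lemma star_disjoint z z' x : cell_class z = cell_class z' -> z != z' ->
  obox (star R z).1 (star R z).2 x -> ~ obox (star R z').1 (star R z').2 x.
Proof.
have main z1 z2 i : (z1 i < z2 i)%N -> (z1 i %% 12 = z2 i %% 12)%N ->
    obox (star R z1).1 (star R z1).2 x -> ~ obox (star R z2).1 (star R z2).2 x.
  move=> lt e /(_ i) + /(_ i); rewrite !mxE -!mulrDl => /andP[_ x1] /andP[x2 _].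
  have := lt_trans x2 x1; rewrite ltr_pM2r// -natrD ltr_nat ltnNge.
  by rewrite clamp_far// -ltnS.
move=> /ffunP cl zz'.
have cE i : (z i %% 12 = z' i %% 12)%N.
  by have := cl i; rewrite !ffunE => /(congr1 val) /=; rewrite !inordK// ltn_pmod.
have [i zi] : exists i, z i != z' i.
  by apply/existsP; apply: contraR zz' => /existsPn h; apply/eqP/ffunP => i; apply/eqP/negPn/h.
have [lt|gt|e] := ltngtP (z i) (z' i); first exact: (main z z' i).
  by move=> h h'; exact: (main z' z i gt (esym (cE i)) h' h).
by case/eqP: zi; apply: val_inj.
Qed.

Lemma star_inj z z' : cell_class z = cell_class z' -> star R z = star R z' -> z = z'.
Proof.
move=> cl sE; apply/eqP; apply: contraT => zz'.
have ox : obox (star R z).1 (star R z).2 ((star R z).1 + const_mx ((star R z).2 / 2)).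
  move: (star R z) (star_gt0 R z) => [a r] /= r0 i; rewrite !mxE.
  by apply/andP; split; lra.
by have := star_disjoint cl zz' ox; rewrite -sE.
Qed.

(** Each class of cells modulo 12 yields a packing by stars, and there are 12^d
    classes. *)
Lemma sum_star_err_le f (S : R) : bounded_on f (box 0 1) ->
  (forall s, seq_packing s -> (forall Q, Q \in s -> Q.2 <= 6 / N%:R) ->
     var_sum k p f s <= S) ->
  \sum_z star_err f z `^ p <= 12 ^+ d * S.
Proof.
move=> fb HS; rewrite (partition_big cell_class xpredT)//=.
apply: (@le_trans _ _ (\sum_(c : {ffun 'I_d -> 'I_12}) S)); last first.
  by rewrite sumr_const card_ffun !card_ord -[leLHS]mulr_natl natrX.
apply: ler_sum => c _; pose s := [seq star R z | z <- enum [pred z | cell_class z == c]].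
have mem Q : Q \in s -> exists2 z, cell_class z = c & Q = star R z.
  by move=> /mapP[z]; rewrite mem_enum inE => /eqP zc ->; exists z.
have := HS s; rewrite /var_sum big_map big_enum; apply.
  split.
  - rewrite map_inj_in_uniq ?enum_uniq// => z z'.
    rewrite !mem_enum !inE => /eqP zc /eqP zc'; apply: star_inj.
    by rewrite zc zc'.
  - move=> Q /mem[z _ ->]; split; first exact: star_gt0.
    by rewrite (cube_setE (star_gt0 R z)) unit_cubeE; exact: star_unit.
  - move=> Q Q' /mem[z zc ->] /mem[z' zc' ->] zz' x.
    by apply: star_disjoint; [rewrite zc zc'|apply: contraNneq zz' => ->].
by move=> Q /mem[z _ ->].
Qed.

(** The cubes of a packing attached to one cell contribute boundedly: shrunk to at
    most the size of a cell around their points in that cell, they lie in a box of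
    side 3/N. *)
Lemma sum_capped_le s (x : 'rV[R]_d * R -> 'rV[R]_d) z : seq_packing s ->
  (forall Q, Q \in s -> box Q.1 Q.2 (x Q)) ->
  \sum_(Q <- s | cell_of (x Q) == z) (N%:R * capped Q) ^+ d <= 12 ^+ d.
Proof.
move=> ps xQ; have [us cs ds] := ps.
have c0 Q : Q \in s -> 0 < capped Q.
  by move=> /cs[Q0 _]; rewrite lt_min Q0.
have cN Q : capped Q <= N%:R^-1 by rewrite ge_min lexx orbT.
have cQ Q : capped Q <= Q.2 by rewrite ge_min lexx.
under eq_bigr do rewrite exprMn; rewrite -mulr_sumr.
(* The shrunk cube contains x Q and is pushed back into Q on the upper side. *)
pose corner Q : 'rV[R]_d :=
  \row_i Num.min (x Q ord0 i) (Q.1 ord0 i + Q.2 - capped Q).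
have cornerP Q i : Q \in s -> [/\ Q.1 ord0 i <= corner Q ord0 i,
    corner Q ord0 i + capped Q <= Q.1 ord0 i + Q.2,
    corner Q ord0 i <= x Q ord0 i & x Q ord0 i <= corner Q ord0 i + capped Q].
  move=> Qs; have /andP[x1 x2] := xQ _ Qs i.
  have h1 := cQ Q; have h2 := c0 _ Qs; rewrite mxE.
  move: (capped Q) h1 h2 => t h1 h2.
  by case: (leP (x Q ord0 i) (Q.1 ord0 i + Q.2 - t)) => h; split; lra.
have V : \sum_(Q <- [seq Q <- s | cell_of (x Q) == z]) capped Q ^+ d <=
    (4 * (3 / N%:R)) ^+ d.
  apply: (@volume_le _ _ _ _ corner capped (\row_i (((z i)%:R - 1) / N%:R))).
  - by rewrite divr_gt0.
  - exact: filter_uniq.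
  - move=> Q; rewrite mem_filter => /andP[/eqP zQ Qs]; split; first exact: c0.
    move=> i; have [k1 k2 k3 k4] := cornerP Q i Qs.
    have xu := packing_box ps Qs (xQ _ Qs).
    have := cell_ofP i xu; rewrite zQ => -[z1 z2].
    have z1' : (z i)%:R / N%:R <= x Q ord0 i by rewrite ler_pdivrMr// mulrC.
    have z2' : x Q ord0 i <= ((z i)%:R + 1) / N%:R by rewrite ler_pdivlMr// mulrC.
    rewrite [(\row__ _) _ _]mxE; have cNQ := cN Q.
    move: (corner Q) (capped Q) k1 k2 k3 k4 cNQ => y t k1 k2 k3 k4 cNQ.
    by move: N%:R^-1 z1' z2' cNQ => w z1' z2' cNQ; split; lra.
  - move=> Q Q'; rewrite !mem_filter => /andP[_ Qs] /andP[_ Q's] QQ' y yQ yQ'.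
    have inQ P : P \in s -> obox (corner P) (capped P) y -> obox P.1 P.2 y.
      move=> Ps yP i; have [k1 k2 _ _] := cornerP P i Ps.
      by have /andP[y1 y2] := yP i; rewrite (le_lt_trans k1 y1) (lt_le_trans y2 k2).
    by have := ds _ _ Qs Q's QQ' y (inQ _ Qs yQ) (inQ _ Q's yQ').
rewrite big_filter in V; apply: le_trans (ler_wpM2l _ V) _; first by rewrite exprn_ge0.
have E : N%:R * (4 * (3 / N%:R)) = 12 * (N%:R * N%:R^-1) :> R by ring.
by rewrite -exprMn E NV mulr1.
Qed.

(** The small cubes contribute the variation of f over them. The remaining terms are
    grouped by cells; the exponent kp of the capped sides is lowered to d, after
    which the volume bound applies in every cell. *)
Lemma var_sum_quasi_interp f (S : R) s : bounded_on f (box 0 1) ->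
  (forall s, seq_packing s -> (forall Q, Q \in s -> Q.2 <= 6 / N%:R) ->
     var_sum k p f s <= S) ->
  seq_packing s ->
  var_sum k p (fun y => f y - quasi_interp k n f y) s <=
    2 `^ p * (1 + L `^ p * 12 ^+ d * 12 ^+ d) * S.
Proof.
move=> fb HS ps; have [us cs ds] := ps; have L0 := local_const_ge0.
have /choice[x Hx] Q : exists x, Q \in s -> box Q.1 Q.2 x /\
  err k (fun y => f y - quasi_interp k n f y) (cube_set Q) <=
    (if Q.2 <= N%:R^-1 then err k f (cube_set Q) else 0) +
    L * star_err f (cell_of x) * (N%:R * capped Q) ^+ k.
  have [Qs|] := boolP (Q \in s); last by exists 0.
  have [Q0 _] := cs _ Qs.
  by have [x xQ hx] := err_quasi_interp fb Q0 (packing_box ps Qs); exists x.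
pose A := \sum_(Q <- s | Q.2 <= N%:R^-1) err k f (cube_set Q) `^ p.
pose B := \sum_(Q <- s) star_err f (cell_of (x Q)) `^ p * (N%:R * capped Q) ^+ d.
have AS : A <= S.
  rewrite /A -big_filter; apply: HS; first exact: seq_packing_filter.
  move=> Q; rewrite mem_filter => /andP[/le_trans h _]; apply: h.
  by rewrite -[leLHS]mul1r ler_wpM2r ?(ltW NV0)// ler1n.
have BS : B <= 12 ^+ d * (12 ^+ d * S).
  rewrite /B (partition_big (fun Q => cell_of (x Q)) xpredT)//=.
  apply: le_trans (ler_wpM2l _ (sum_star_err_le fb HS)); last by rewrite exprn_ge0.
  rewrite mulr_sumr; apply: ler_sum => z _.
  rewrite (eq_bigr (fun Q => star_err f z `^ p * (N%:R * capped Q) ^+ d)); last first.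
    by move=> Q /eqP ->.
  rewrite -mulr_sumr mulrC ler_wpM2r ?powR_ge0//.
  by apply: sum_capped_le => // Q /Hx[].
apply: (@le_trans _ _ (2 `^ p * (A + L `^ p * B))); last first.
  rewrite -mulrA ler_wpM2l ?powR_ge0// mulrDl mul1r lerD// -!mulrA.
  by rewrite ler_wpM2l ?powR_ge0.
rewrite /A big_mkcond /= /B mulr_sumr -big_split mulr_sumr /var_sum.
rewrite big_seq [leRHS]big_seq; apply: ler_sum => Q Qs.
have [xQ hQ] := Hx _ Qs; have [Q0 _] := cs _ Qs; have An0 := cube_set_neq0 Q0.
have c0 : 0 <= N%:R * capped Q by rewrite mulr_ge0// le_min (ltW Q0) (ltW NV0).
have c1 : N%:R * capped Q <= 1.
  by rewrite -[leRHS]NV ler_wpM2l// ge_min lexx orbT.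
set u := (if _ then err k f _ else _) in hQ.
have u0 : 0 <= u by rewrite /u; case: ifP => _ //; exact: err_ge0.
have -> : (if Q.2 <= N%:R^-1 then err k f (cube_set Q) `^ p else 0) = u `^ p.
  by rewrite /u; case: ifP => // _; rewrite powR0// gt_eqF.
have se := star_err_ge0 f (cell_of (x Q)).
apply: le_trans (_ : _ <= (u + L * star_err f (cell_of (x Q)) * (N%:R * capped Q) ^+ k) `^ p) _.
  rewrite ge0_ler_powR ?nnegrE ?(ltW p0) ?err_ge0//.
  by rewrite addr_ge0 ?mulr_ge0 ?exprn_ge0.
apply: le_trans (powR_add_le hp u0 _) _; first by rewrite !mulr_ge0 ?exprn_ge0.
rewrite ler_wpM2l ?powR_ge0// lerD2l powRM ?mulr_ge0 ?exprn_ge0// powRM//.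
rewrite -mulrA ler_wpM2l ?powR_ge0// ler_wpM2l ?powR_ge0//.
rewrite (exprn_powR hd hp hs)// ler_piMr ?exprn_ge0//.
apply: (@le_trans _ _ (1 `^ (k%:R * p - d%:R))); last by rewrite powR1.
rewrite ge0_ler_powR ?nnegrE//.
by rewrite subr_ge0 ltW// -ltr_pdivrMr.
Qed.

End Counting.

(** * The characterization *)

(** The quasi-interpolants on finer and finer grids converge to f: the variation of
    the error is at most a constant times the variation of f over the cubes of side
    at most 6/N. *)
Lemma small_var_v_space (R : realType) (d k : nat) (p : R)
    (hd : (0 < d)%N) (hk : (0 < k)%N) (hp : 1 <= p) (hs : d%:R / p < k%:R)
    (f : 'rV[R]_d -> R) : V_space k p f ->
  (forall e : R, 0 < e -> exists2 eps : R, 0 < eps & (small_var k p f eps <= e%:E)%E) ->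
  v_space k p f.
Proof.
move=> Vf; have [/bounded_onP fb _] := Vf; move=> Hf; split=> // e e0.
have p0 : 0 < p by exact: lt_le_trans hp.
have fb' : bounded_on f (box 0 1) by rewrite -unit_cubeE.
have [C C0 HC] := shape_bounds R d k.
set K := 2 `^ p * (1 + local_const d k C `^ p * 12 ^+ d * 12 ^+ d).
have K0 : 0 <= K by rewrite mulr_ge0 ?powR_ge0// addr_ge0// !mulr_ge0 ?powR_ge0 ?exprn_ge0.
have K1 : 0 < K + 1 by rewrite ltr_wpDl.
(* K + 1 instead of K to divide by a positive number. *)
pose sigma := e / 2 / (K + 1) `^ p^-1.
have sigma0 : 0 < sigma by rewrite !divr_gt0// powR_gt0.
have [eps eps0 Heps] := Hf _ sigma0.
have [n hn Neps] : exists2 n, (5 <= n)%N & (6 / n.+1%:R : R) ^+ d <= eps.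
  pose n := maxn 5 (Num.truncn (6 / eps)).
  exists n; first by rewrite leq_maxl.
  have n6 : 6 / n.+1%:R <= 1 :> R by rewrite ler_pdivrMr// mul1r ler_nat ltnS leq_maxl.
  apply: (@le_trans _ _ (6 / n.+1%:R)).
    by rewrite -[leRHS]expr1 ler_wiXn2l// divr_ge0.
  rewrite ler_pdivrMr// mulrC -ler_pdivrMr//.
  apply: (@le_trans _ _ (Num.truncn (6 / eps)).+1%:R); first by rewrite ltW// truncnS_gt.
  by rewrite ler_nat ltnS leq_maxr.
pose G := quasi_interp k n f.
have sG : smooth G := smooth_quasi_interp k n f.
exists G.
  by split; [exists G|exact: smooth_V_space].
have [B _ GB] := continuous_bounded_box 0 1 (smooth_continuous sG).
have Gb : bounded_on G (unit_cube R d) by exists B; rewrite unit_cubeE.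
apply: (@le_lt_trans _ _ (e / 2)%:E); last by rewrite lte_fin; lra.
have e2 : 0 <= e / 2 by rewrite divr_ge0 ?ltW.
apply/(V_seminorm_le k hp (bounded_onB fb Gb) e2) => s ps.
have HS s' : seq_packing s' -> (forall Q, Q \in s' -> Q.2 <= 6 / n.+1%:R) ->
    var_sum k p f s' <= sigma `^ p.
  move=> ps' hs'; have [_ cs' _] := ps'.
  apply: ((small_var_le k hp eps fb (ltW sigma0)).1 Heps s' ps') => Q Qs.
  apply: le_trans Neps; have [Q0 _] := cs' _ Qs.
  by rewrite lerXn2r ?nnegrE ?divr_ge0 ?hs'// ltW.
apply: le_trans (var_sum_quasi_interp hd hk hp hs hn C0 HC fb' HS ps) _.
rewrite -/K /sigma powRM ?invr_ge0 ?powR_ge0// mulrCA ler_piMr ?powR_ge0//.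
have -> : ((K + 1) `^ p^-1)^-1 `^ p = (K + 1)^-1.
  rewrite -[((K + 1) `^ _)^-1]powR_inv1 ?powR_ge0// -powRrM mulN1r powRN.
  by rewrite -powRrM mulVf ?gt_eqF// powRr1// ltW.
by rewrite ler_pdivrMr// mul1r lerDl.
Qed.

Theorem theorem2p6 (R : realType) (d k : nat) (p : R)
    (hd : (0 < d)%N) (hk : (0 < k)%N) (hp : 1 <= p)
    (hs : d%:R / p < k%:R)
    (f : 'rV[R]_d -> R) (hf : V_space k p f) :
  v_space k p f <-> small_var k p f eps @[eps --> 0^'+] --> 0%E.
Proof.
split=> [vf|/small_var_cvg0 Hf]; last exact: small_var_v_space.
by apply/small_var_cvg0; exact: v_space_small_var.
Qed.
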